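(* Let $h>0$ and let $A$ be a bounded operator in $L^2(\mathbb{R}^n)$, with Wick symbol $\sigma_h^{\rm Wick}(A)$, Berezin symbol $\sigma_h^{\rm ext}A$ and confinement function $d_hA$. Then: (i) For every $(X,Y)\in\mathbb{R}^{4n}$, $X=(x,\xi)$, $Y=(y,\eta)$, and every $1\le j\le n$, $$(\partial_{x_j}+i\partial_{\xi_j})(\sigma_h^{\rm ext}A)(X,Y)=0,\qquad (\partial_{y_j}-i\partial_{\eta_j})(\sigma_h^{\rm ext}A)(X,Y)=0 .$$ (ii) For all $X\in\mathbb{R}^{2n}$, $(\sigma_h^{\rm ext}A)(X,X)=\sigma_h^{\rm Wick}(A)(X)$. (iii) If $A\in C_h$, then for all $(X,Y)\in\mathbb{R}^{4n}$, $$|(\sigma_h^{\rm ext}A)(X,Y)|\le d_hA(X-Y)\,e^{\frac{1}{4h}|X-Y|^2}.$$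
   Context: The scalar product $\langle\cdot,\cdot\rangle$ of $L^2(\mathbb{R}^n)$ is linear in the first variable and antilinear in the second. For $X=(x,\xi)\in\mathbb{R}^{2n}$ and $h>0$ the coherent state is $$\Psi_{Xh}(u)=(\pi h)^{-n/4}e^{-\frac{|u-x|^2}{2h}}e^{\frac{i}{h}u\cdot\xi-\frac{i}{2h}x\cdot\xi},\quad u\in\mathbb{R}^n.$$ One has $|\langle\Psi_{Xh},\Psi_{Yh}\rangle|=e^{-|X-Y|^2/(4h)}\neq 0$. For a bounded operator $A$ in $L^2(\mathbb{R}^n)$: - Wick symbol: $\sigma_h^{\rm Wick}(A)(X)=\langle A\Psi_{Xh},\Psi_{Xh}\rangle$; - Berezin symbol: $(\sigma_h^{\rm ext}A)(X,Y)=\dfrac{\langle A\Psi_{Xh},\Psi_{Yh}\rangle}{\langle\Psi_{Xh},\Psi_{Yh}\rangle}$; - confinement function: $d_hA(V)=\sup_{X-Y=V}|\langle A\Psi_{Xh},\Psi_{Yh}\rangle|$, $V\in\mathbb{R}^{2n}$. $C_h$ is the space of bounded operators $A$ in $L^2(\mathbb{R}^n)$ with $d_hA\in L^1(\mathbb{R}^{2n})$. *)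

(* Defs.v *)
From HB Require Import structures.
From mathcomp Require Import all_boot all_order all_algebra.
From mathcomp Require Import all_classical all_reals all_analysis.
From mathcomp Require Import measurable_realfun ring_quotient complex ring.

Set Implicit Arguments.
Unset Strict Implicit.
Unset Printing Implicit Defensive.

Import Order.TTheory GRing.Theory Num.Theory.
Import Normc numFieldNormedType.Exports.

Local Open Scope classical_set_scope.
Local Open Scope ring_scope.
Local Open Scope complex_scope.

Definition rV_display : measure_display.
Proof. exact: default_measure_display. Qed.

(* The Borel sigma-algebra of R^n, generated by the coordinate functions. *)
Section rV_measurable.
Variables (R : realType) (n : nat).

Definition rV_coord (i : 'I_n) (u : 'rV[R]_n) : measurableTypeR R := u ord0 i.

Let rV_measurable0 : g_sigma_preimage rV_coord set0.
Proof. exact: sigma_algebra0. Qed.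

Let rV_measurableC A : g_sigma_preimage rV_coord A ->
  g_sigma_preimage rV_coord (~` A).
Proof. exact: sigma_algebraC. Qed.

Let rV_measurable_bigcup (F : (set 'rV[R]_n)^nat) :
  (forall i, g_sigma_preimage rV_coord (F i)) ->
  g_sigma_preimage rV_coord (\bigcup_i F i).
Proof. exact: sigma_algebra_bigcup. Qed.

HB.instance Definition _ := @isMeasurable.Build rV_display 'rV[R]_n
  (g_sigma_preimage rV_coord) rV_measurable0 rV_measurableC rV_measurable_bigcup.

Lemma measurable_rV_coord (i : 'I_n) : measurable_fun [set: 'rV[R]_n] (rV_coord i).
Proof.
move=> _ Y mY; rewrite setTI; apply: sub_sigma_algebra => /=.
rewrite -bigcup_seq/=; exists i => /=; first by rewrite mem_index_enum.
by exists Y => //; rewrite setTI.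
Qed.

Lemma measurable_fun_rVP d (T : measurableType d) (f : T -> 'rV[R]_n) :
  (forall i, measurable_fun [set: T] (rV_coord i \o f)) ->
  measurable_fun [set: T] f.
Proof.
move=> mf.
have S : g_sigma_preimage (fun i => rV_coord i \o f) `<=` measurable.
  apply: smallest_sub; first exact: sigma_algebra_measurable.
  by rewrite -bigcup_seq => A [i _ [B mB <-]]; exact: mf.
move=> _ A mA; apply: S; rewrite g_sigma_preimage_comp.
by exists A.
Qed.

End rV_measurable.

Section lebesgue_rV.
Variable R : realType.

Definition rV_cons n (p : measurableTypeR R * 'rV[R]_n) : 'rV[R]_n.+1 :=
  \row_i (if unlift ord0 i is Some j then p.2 ord0 j else p.1).

Definition rV_uncons n (u : 'rV[R]_n.+1) : measurableTypeR R * 'rV[R]_n :=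
  (u ord0 ord0, \row_i u ord0 (lift ord0 i)).

Lemma rV_cons0 n (p : measurableTypeR R * 'rV[R]_n) : rV_cons p ord0 ord0 = p.1.
Proof.
by rewrite mxE unlift_none.
Qed.

Lemma rV_consS n (p : measurableTypeR R * 'rV[R]_n) i :
  rV_cons p ord0 (lift ord0 i) = p.2 ord0 i.
Proof.
by rewrite mxE liftK.
Qed.

Lemma rV_consK n : cancel (@rV_cons n) (@rV_uncons n).
Proof.
move=> [x u]; rewrite /rV_uncons rV_cons0; congr pair.
by apply/rowP => i; rewrite mxE rV_consS.
Qed.

Lemma measurable_rV_cons n : measurable_fun setT (@rV_cons n).
Proof.
apply: measurable_fun_rVP => i; case: (unliftP ord0 i) => [j|] ->.
  rewrite (_ : _ \o _ = rV_coord j \o snd); last first.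
    by apply/funext => p; rewrite /rV_coord/= rV_consS.
  by apply: measurableT_comp; [exact: measurable_rV_coord|].
rewrite (_ : _ \o _ = fst)//.
by apply/funext => p; rewrite /rV_coord/= rV_cons0.
Qed.

Lemma measurable_rV_uncons n : measurable_fun setT (@rV_uncons n).
Proof.
apply: measurable_fun_pair => /=; first exact: (measurable_rV_coord ord0).
apply: measurable_fun_rVP => i.
rewrite (_ : _ \o _ = rV_coord (lift ord0 i)); first exact: measurable_rV_coord.
by apply/funext => u; rewrite /rV_coord/= mxE.
Qed.

Section step.
Variables (n : nat) (mu : {sigma_finite_measure set 'rV[R]_n -> \bar R}).
Local Open Scope ereal_scope.

Definition lebesgue_rVS : set 'rV[R]_n.+1 -> \bar R :=
  pushforward (@lebesgue_measure R \x mu) (@rV_cons n).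

Let lebesgue_rVS0 : lebesgue_rVS set0 = 0.
Proof. by rewrite /lebesgue_rVS /pushforward preimage_set0 measure0. Qed.

Let lebesgue_rVS_ge0 A : 0 <= lebesgue_rVS A.
Proof. exact: (measure_ge0 (@lebesgue_measure R \x mu)). Qed.

Let lebesgue_rVS_sigma_additive : semi_sigma_additive lebesgue_rVS.
Proof.
have mcons A : measurable A -> measurable (@rV_cons n @^-1` A).
  by move=> mA; rewrite -[X in measurable X]setTI; exact: measurable_rV_cons.
move=> F mF tF mUF; rewrite /lebesgue_rVS /pushforward preimage_bigcup.
apply: (measure_semi_sigma_additive (s := @lebesgue_measure R \x mu)).
- by move=> k; exact: mcons.
- apply/trivIsetP => i j _ _ ij; rewrite -preimage_setI.
  by move/trivIsetP : tF => ->//; rewrite preimage_set0.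
- by rewrite -preimage_bigcup; exact: mcons.
Qed.

HB.instance Definition _ := isMeasure.Build _ _ _ lebesgue_rVS
  lebesgue_rVS0 lebesgue_rVS_ge0 lebesgue_rVS_sigma_additive.

Let lebesgue_rVS_sigma_finite : sigma_finite setT lebesgue_rVS.
Proof.
have [F FT Foo] : sigma_finite setT (@lebesgue_measure R \x mu).
  have /sigma_finiteP[F [TF ndF Foo]] := sigma_finiteT (@lebesgue_measure R).
  have /sigma_finiteP[G [TG ndG Goo]] := sigma_finiteT mu.
  exists (fun k => F k `*` G k).
    rewrite -setXTT TF TG predeqE => -[x y]; split.
      move=> [/= [k _ Fkx] [l _ Gly]]; exists (maxn k l) => //; split.
      - by move: x Fkx; exact/subsetPset/ndF/leq_maxl.
      - by move: y Gly; exact/subsetPset/ndG/leq_maxr.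
    by move=> [k _ []/= ? ?]; split; exists k.
  move=> k; have [? ?] := Foo k; have [? ?] := Goo k.
  split; first exact: measurableX.
  by rewrite product_measure1E// lte_mul_pinfty// ge0_fin_numE.
exists (fun k => @rV_uncons n @^-1` F k).
  by rewrite -preimage_bigcup -FT preimage_setT.
move=> k; have [mF Fk] := Foo k; split.
  by rewrite -[X in measurable X]setTI; exact: measurable_rV_uncons.
rewrite /lebesgue_rVS /pushforward -comp_preimage.
by rewrite (_ : _ \o _ = id) ?preimage_id//; apply/funext => p /=; rewrite rV_consK.
Qed.

HB.instance Definition _ := @Measure_isSigmaFinite.Build _ _ _ lebesgue_rVS
  lebesgue_rVS_sigma_finite.

End step.

(* Lebesgue measure on R^n, by iterated products; lebesgue_rV_box below
   computes it on boxes. *)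
Fixpoint lebesgue_rV n : {sigma_finite_measure set 'rV[R]_n -> \bar R} :=
  match n with
  | 0 => \d_(0 : 'rV[R]_0)
  | m.+1 => lebesgue_rVS (lebesgue_rV m)
  end.
End lebesgue_rV.

Lemma lebesgue_rV_box (R : realType) n (B : 'I_n -> set (measurableTypeR R)) :
  (forall i, measurable (B i)) ->
  lebesgue_rV R n [set u | forall i, B i (rV_coord i u)] =
  (\prod_(i < n) lebesgue_measure (B i))%E.
Proof.
elim: n B => [|n IHn] B mB.
  rewrite big_ord0 /= diracE mem_set//; by case.
rewrite big_ord_recl -(IHn (fun i => B (lift ord0 i)))//=.
rewrite /lebesgue_rVS /pushforward -product_measure1E//.
  congr (_ _); apply/seteqP; split => [[x u] /= Bu|[x u]/= [Bx Bu] i].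
    split=> [|i].
      by have := Bu ord0; rewrite /rV_coord rV_cons0.
    by have := Bu (lift ord0 i); rewrite /rV_coord rV_consS.
  by case: (unliftP ord0 i) => [j|] ->; rewrite /rV_coord ?rV_cons0 ?rV_consS.
rewrite (_ : [set _ | _] = \bigcap_(i in [set: 'I_n]) (rV_coord i @^-1` B (lift ord0 i))).
  apply: fin_bigcap_measurable => // i _.
  by rewrite -[X in measurable X]setTI; exact: measurable_rV_coord.
by apply/seteqP; split => u /= Bu i => [_|]; exact: Bu.
Qed.

(* The complex Hilbert space L^2(mu): square-integrable functions T -> R[i]
   modulo equality mu-almost everywhere. *)
Section cL2.
Context d (T : measurableType d) (R : realType) (mu : {measure set T -> \bar R}).

Definition cmeasurable (f : T -> R[i]) : Prop :=
  measurable_fun [set: T] (fun u => complex.Re (f u) : R) /\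
  measurable_fun [set: T] (fun u => complex.Im (f u) : R).

Definition cL2fun_pred : {pred T -> R[i]} :=
  fun f => `[< cmeasurable f /\ finite_norm mu 2%:E (fun u => normc (f u)) >].

Lemma measurable_normc f : cmeasurable f ->
  measurable_fun [set: T] (fun u => normc (f u)).
Proof.
move=> [mr mi].
rewrite (_ : (fun _ => _) = fun u => Num.sqrt (complex.Re (f u) ^+ 2 + complex.Im (f u) ^+ 2)).
  apply: (measurableT_comp (continuous_measurable_fun (@sqrt_continuous R))).
  apply: measurable_funD; exact: measurable_funX.
by apply/funext => u; case: (f u).
Qed.

Lemma normc_ge0 (z : R[i]) : 0 <= normc z.
Proof. by case: z => a b; exact: sqrtr_ge0. Qed.

Lemma le_normcB (z w : R[i]) : normc (z - w) <= normc z + normc w.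
Proof. by rewrite -lecR rmorphD/=; exact: (@ler_normB _ R[i]). Qed.

Lemma finite_norm_le (f g : T -> R) : measurable_fun [set: T] f ->
  measurable_fun [set: T] g -> (forall u, 0 <= f u <= g u) ->
  finite_norm mu 2%:E g -> finite_norm mu 2%:E f.
Proof.
move=> mf mg fg lg; apply: le_lt_trans lg.
have ge0 (k : T -> R) : (0 <= \int[mu]_x `|(k x)%:E| `^ 2)%E.
  by apply: integral_ge0 => u _; exact: poweR_ge0.
rewrite unlock; apply: gt0_ler_poweR; rewrite ?invr_ge0// ?in_itv/= ?leey ?ge0//.
have m2 (k : T -> R) : measurable_fun [set: T] k ->
    measurable_fun [set: T] (fun u => (`|k u| `^ 2)%:E).
  move=> mk.
  apply/measurable_EFinP; apply: (measurableT_comp (measurable_powR _)).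
  exact: measurableT_comp.
apply: ge0_le_integral => //.
- exact: m2.
- exact: m2.
move=> u _; have /andP[f0 fgu] := fg u.
rewrite lee_fin !ger0_norm ?(le_trans f0 fgu)//.
by rewrite ge0_ler_powR// nnegrE (le_trans f0 fgu).
Qed.

Lemma cL2fun_zmod_closed : zmod_closed cL2fun_pred.
Proof.
split.
  apply/asboolP; split; first by split; exact: measurable_cst.
  rewrite (_ : (fun _ => _) = cst 0); last first.
    by apply/funext => u; rewrite normc0.
  by rewrite /finite_norm Lnorm0// eqe pnatr_eq0.
move=> f g /asboolP[mf lf] /asboolP[mg lg]; apply/asboolP.
have mfg : cmeasurable (f - g).
  split.
    rewrite (_ : (fun _ => _) = fun u => complex.Re (f u) - complex.Re (g u)).
      by apply: measurable_funB; [case: mf|case: mg].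
    by apply/funext => u /=; rewrite !fctE; case: (f u); case: (g u).
  rewrite (_ : (fun _ => _) = fun u => complex.Im (f u) - complex.Im (g u)).
    by apply: measurable_funB; [case: mf|case: mg].
  by apply/funext => u /=; rewrite !fctE; case: (f u); case: (g u).
split => //.
have -> : (fun u => normc ((f - g) u)) = fun u => normc (f u - g u) by [].
pose nf u : R := normc (f u); pose ng u : R := normc (g u).
apply: (@finite_norm_le _ (nf \+ ng)) => //.
- exact: measurable_normc mfg.
- by apply: measurable_funD; exact: measurable_normc.
- by move=> u; rewrite normc_ge0 le_normcB.
apply: (le_lt_trans (eminkowski _ _ _ _)).
- exact: measurable_normc.
- exact: measurable_normc.
- by rewrite lee_fin ler1n.
- by rewrite lte_add_pinfty.
Qed.

HB.instance Definition _ :=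
  GRing.isZmodClosed.Build (T -> R[i]) cL2fun_pred cL2fun_zmod_closed.

Record cL2fun := CL2fun {
  cL2fun_val :> T -> R[i];
  cL2funP : cL2fun_val \in cL2fun_pred }.

HB.instance Definition _ := [isSub for cL2fun_val].
HB.instance Definition _ := [Choice of cL2fun by <:].
HB.instance Definition _ := [SubChoice_isSubZmodule of cL2fun by <:].

Lemma cL2fun_scale_subproof (a : R[i]) (f : cL2fun) :
  (fun u => a * f u) \in cL2fun_pred.
Proof.
have /asboolP[[mr mi] lf] := cL2funP f.
have m : cmeasurable (fun u => a * f u).
  split.
    rewrite (_ : (fun _ => _) = fun u =>
        complex.Re a * complex.Re (f u) - complex.Im a * complex.Im (f u)).
      by apply: measurable_funB; exact: measurable_funM.
    by apply/funext => u; case: a => ? ?; case: (f u).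
  rewrite (_ : (fun _ => _) = fun u =>
      complex.Re a * complex.Im (f u) + complex.Im a * complex.Re (f u)).
    by apply: measurable_funD; exact: measurable_funM.
  by apply/funext => u; case: a => ? ?; case: (f u).
apply/asboolP; split => //.
under eq_fun do rewrite normcM.
have : (fun u => normc (f u)) \in Lfun mu 2%:E.
  by rewrite inE; apply/andP; split; rewrite inE//; exact: measurable_normc.
move=> /(Lfun_scale (normc a)) /= /(_ (ler1n _ 2)).
rewrite inE => /andP[_]; rewrite inE /=.
rewrite (_ : _ \o* _ = fun u => normc a * normc (f u))//.
by apply/funext => u/=; rewrite mulrC.
Qed.

Definition cL2fun_scale a f := CL2fun (cL2fun_scale_subproof a f).

Definition cL2null_pred : {pred cL2fun} :=
  fun f => `[< {ae mu, forall u, f u = 0} >].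

Lemma cL2null_zmod_closed : zmod_closed cL2null_pred.
Proof.
split; first by apply/asboolP; apply: nearW => u.
move=> f g /asboolP f0 /asboolP g0; apply/asboolP.
by apply: filterS2 f0 g0 => u /= fu gu; rewrite -[LHS]/(f u - g u) fu gu subr0.
Qed.

HB.instance Definition _ :=
  GRing.isZmodClosed.Build cL2fun cL2null_pred cL2null_zmod_closed.

Definition cL2 : Type := Quotient.quot cL2null_pred.
HB.instance Definition _ := GRing.Zmodule.on cL2.

Definition cL2_of (f : cL2fun) : cL2 := \pi_(Quotient.quot cL2null_pred)%qT f.
Definition cL2_repr (f : cL2) : T -> R[i] := repr f.

Definition cL2_scale (a : R[i]) (f : cL2) : cL2 := cL2_of (cL2fun_scale a (repr f)).

Lemma cL2_ofZ a f : cL2_scale a (cL2_of f) = cL2_of (cL2fun_scale a f).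
Proof.
apply/eqP; rewrite /cL2_scale /cL2_of piE Quotient.equivE.
have : repr (\pi_(Quotient.quot cL2null_pred)%qT f) - f \in cL2null_pred.
  by rewrite Quotient.idealrBE reprK.
move=> /asboolP h; apply/asboolP; apply: filterS h => u /= h.
rewrite -[LHS]/(a * _ u - a * f u) -mulrBr.
by rewrite [X in a * X](_ : _ = 0) ?mulr0.
Qed.

Lemma cL2_reprK f : {ae mu, forall u, cL2_repr (cL2_of f) u = f u}.
Proof.
have : repr (\pi_(Quotient.quot cL2null_pred)%qT f) - f \in cL2null_pred.
  by rewrite Quotient.idealrBE reprK.
move=> /asboolP; apply: filterS => u /= h.
by apply/eqP; rewrite -subr_eq0; apply/eqP.
Qed.

Lemma cL2_ofD f g : cL2_of f + cL2_of g = cL2_of (f + g).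
Proof. by rewrite /cL2_of; apply/esym; exact: pi_addr. Qed.

Lemma cL2_ofK (f : cL2) : cL2_of (repr f) = f.
Proof. exact: reprK. Qed.

Lemma cL2_scaleA a b f : cL2_scale a (cL2_scale b f) = cL2_scale (a * b) f.
Proof.
rewrite -[f]cL2_ofK !cL2_ofZ; congr cL2_of.
by apply: val_inj; apply/funext => u /=; rewrite mulrA.
Qed.

Lemma cL2_scale1 : left_id 1 cL2_scale.
Proof.
move=> f; rewrite -[f]cL2_ofK cL2_ofZ; congr cL2_of.
by apply: val_inj; apply/funext => u /=; rewrite mul1r.
Qed.

Lemma cL2_scaleDr : right_distributive cL2_scale +%R.
Proof.
move=> a f g; rewrite -[f]cL2_ofK -[g]cL2_ofK cL2_ofD !cL2_ofZ cL2_ofD.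
by congr cL2_of; apply: val_inj; apply/funext => u /=; rewrite mulrDr.
Qed.

Lemma cL2_scaleDl f : {morph cL2_scale^~ f : a b / a + b}.
Proof.
move=> a b; rewrite -[f]cL2_ofK !cL2_ofZ cL2_ofD.
by congr cL2_of; apply: val_inj; apply/funext => u /=; rewrite mulrDl.
Qed.

HB.instance Definition _ := GRing.Zmodule_isLmodule.Build R[i] cL2
  cL2_scaleA cL2_scale1 cL2_scaleDr cL2_scaleDl.

Definition cintegral (f : T -> R[i]) : R[i] :=
  (\int[mu]_u complex.Re (f u)) +i* (\int[mu]_u complex.Im (f u)).

Definition cL2_inner (f g : cL2) : R[i] :=
  cintegral (fun u => cL2_repr f u * (cL2_repr g u)^*).

Definition cL2_norm (f : cL2) : R :=
  fine ('N[mu]_2%:E[EFin \o (fun u => normc (cL2_repr f u))])%E.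

Definition cL2_bounded (A : {linear cL2 -> cL2}) : Prop :=
  exists M : R, forall f, cL2_norm (A f) <= M * cL2_norm f.

End cL2.

Section product_integral.
Variable R : realType.
Local Open Scope ereal_scope.

Lemma measurable_rV_prod n (f : 'I_n -> R -> R) :
  (forall i, measurable_fun [set: measurableTypeR R] (f i)) ->
  measurable_fun [set: 'rV[R]_n] (fun u => \prod_(i < n) f i (u ord0 i))%R.
Proof.
move=> mf; apply: measurable_prod => i _.
exact: (measurableT_comp (mf i) (measurable_rV_coord i)).
Qed.

Lemma integral_rV_prod n (f : 'I_n -> R -> R) :
  (forall i, measurable_fun [set: measurableTypeR R] (f i)) ->
  (forall i t, 0 <= f i t)%R ->
  \int[lebesgue_rV R n]_u (\prod_(i < n) f i (u ord0 i))%:E =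
  \prod_(i < n) \int[@lebesgue_measure R]_t (f i t)%:E.
Proof.
elim: n f => [|n IHn] f mf f0.
  rewrite big_ord0; under eq_integral do rewrite big_ord0.
  by rewrite integral_cst//= diracT mule1.
have mF := measurable_rV_prod mf.
have F0 (u : 'rV[R]_n.+1) : (0 <= \prod_(i < n.+1) f i (u ord0 i))%R by apply: prodr_ge0.
rewrite /= /lebesgue_rVS ge0_integral_pushforward//; last 3 first.
- exact: measurable_rV_cons.
- exact/measurable_EFinP.
- by move=> u _; rewrite lee_fin.
rewrite preimage_setT.
rewrite fubini_tonelli1//; last 2 first.
- apply/measurable_EFinP.
  exact: (measurableT_comp mF (@measurable_rV_cons R n)).
- by move=> p; rewrite lee_fin.
rewrite big_ord_recl -(IHn (fun i => f (lift ord0 i)))//.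
pose P (u : 'rV[R]_n) := (\prod_(i < n) f (lift ord0 i) (u ord0 i))%R.
have P0 u : (0 <= P u)%R by apply: prodr_ge0.
rewrite (eq_integral (fun t : measurableTypeR R => (f ord0 t)%:E * \int[lebesgue_rV R n]_u (P u)%:E)).
  rewrite ge0_integralZr//.
  - exact/measurable_EFinP.
  - by move=> t _; rewrite lee_fin.
  - by apply: integral_ge0 => u _; rewrite lee_fin.
move=> t _; rewrite /fubini_F -ge0_integralZl//.
- apply: eq_integral => u _; rewrite /= big_ord_recl rV_cons0 EFinM.
  by under eq_bigr do rewrite rV_consS.
- apply/measurable_EFinP.
  exact: (measurable_rV_prod (fun i => mf (lift ord0 i))).
- by move=> u _; rewrite lee_fin.
- by rewrite lee_fin.
Qed.

Lemma integral_gauss_lty (h m : R) : (0 < h)%R ->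
  \int[@lebesgue_measure R]_t (expR (- (t - m) ^+ 2 / h))%:E < +oo.
Proof.
move=> h0; pose s : R := Num.sqrt (h / 2).
have s0 : s != 0%R by rewrite gt_eqF// sqrtr_gt0 divr_gt0.
have sE : (s ^+ 2 *+ 2 = h)%R.
  by rewrite sqr_sqrtr ?divr_ge0 ?ltW// -mulr_natr divfK.
have pE t : (expR (- (t - m) ^+ 2 / h) = (normal_peak s)^-1 * normal_pdf m s t)%R.
  rewrite normal_pdfE// mulrA mulVf ?mul1r ?gt_eqF ?normal_peak_gt0//.
  by rewrite /normal_fun sE.
under eq_integral do rewrite pE EFinM.
rewrite ge0_integralZl//.
- by rewrite integral_normal_pdf mule1 ltry.
- by apply/measurable_EFinP; exact: measurable_normal_pdf.
- by move=> t _; rewrite lee_fin normal_pdf_ge0.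
- by rewrite lee_fin invr_ge0 normal_peak_ge0.
Qed.

End product_integral.

Notation phase R n := ('rV[R]_n * 'rV[R]_n)%type.
Notation L2 R n := (cL2 (lebesgue_rV R n)).

Section coherent.
Variables (R : realType) (n : nat).
Implicit Types (x y u : 'rV[R]_n) (X : phase R n) (h : {posnum R}).

Definition dot x y : R := \sum_(i < n) x ord0 i * y ord0 i.

Definition cexp (z : R[i]) : R[i] :=
  (expR (complex.Re z))%:C * (cos (complex.Im z) +i* sin (complex.Im z)).

Definition coherent_fun h X u : R[i] :=
  ((pi * h%:num) `^ (- n%:R / 4)
    * expR (- dot (u - X.1) (u - X.1) / (2 * h%:num)))%:C
  * cexp ('i%C * (dot u X.2 / h%:num)%:C
          - 'i%C * (dot X.1 X.2 / (2 * h%:num))%:C).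

Lemma coherent_funE h X u : coherent_fun h X u =
  let r := (pi * h%:num) `^ (- n%:R / 4) * expR (- dot (u - X.1) (u - X.1) / (2 * h%:num)) in
  let t := dot u X.2 / h%:num - dot X.1 X.2 / (2 * h%:num) in
  (r * cos t) +i* (r * sin t).
Proof.
rewrite /coherent_fun /cexp; set r := _ * expR _; simpc => /=.
by rewrite expR0; simpc.
Qed.

Lemma measurable_dotl (x : 'rV[R]_n) : measurable_fun setT (fun u => dot u x).
Proof.
apply: measurable_sum => i; apply: measurable_funM => //.
exact: measurable_rV_coord.
Qed.

Lemma coherent_fun_L2 h X : coherent_fun h X \in cL2fun_pred (lebesgue_rV R n).
Proof.
pose r u := (pi * h%:num) `^ (- n%:R / 4) * expR (- dot (u - X.1) (u - X.1) / (2 * h%:num)).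
pose t u := dot u X.2 / h%:num - dot X.1 X.2 / (2 * h%:num).
have mr : measurable_fun setT r.
  apply: measurable_funM => //; apply: measurableT_comp => //.
  apply: measurable_funM => //; apply: measurableT_comp => //.
  apply: measurable_sum => i.
  rewrite (_ : (fun _ => _) = fun u => (u ord0 i - X.1 ord0 i) * (u ord0 i - X.1 ord0 i)).
    by apply: measurable_funM; apply: measurable_funB => //; exact: measurable_rV_coord.
  by apply/funext => u; rewrite !mxE.
have mt : measurable_fun setT t.
  apply: measurable_funB => //; apply: measurable_funM => //.
  exact: measurable_dotl.
apply/asboolP; split.
  split.
    rewrite (_ : (fun _ => _) = fun u => r u * cos (t u)).
      apply: measurable_funM => //; apply: measurableT_comp => //.
      exact: (continuous_measurable_fun (@continuous_cos R)).
    by apply/funext => u; rewrite coherent_funE.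
  rewrite (_ : (fun _ => _) = fun u => r u * sin (t u)).
    apply: measurable_funM => //; apply: measurableT_comp => //.
    exact: (continuous_measurable_fun (@continuous_sin R)).
  by apply/funext => u; rewrite coherent_funE.
rewrite (_ : (fun _ => _) = r); last first.
  apply/funext => u; rewrite coherent_funE/=.
  have nE (a b : R) : 0 <= a -> Num.sqrt ((a * cos b) ^+ 2 + (a * sin b) ^+ 2) = a.
    by move=> a0; rewrite !exprMn -mulrDr cos2Dsin2 mulr1 sqrtr_sqr ger0_norm.
  by rewrite nE// mulr_ge0 ?powR_ge0 ?expR_ge0.
rewrite /finite_norm unlock; apply: poweR_lty.
pose c := ((pi * h%:num) `^ (- n%:R / 4)) ^+ 2.
pose g i t := expR (- (t - X.1 ord0 i) ^+ 2 / h%:num).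
have rE u : (`|(EFin \o r) u| `^ 2 = c%:E * (\prod_(i < n) g i (u ord0 i))%:E)%E.
  rewrite /= ger0_norm ?mulr_ge0 ?powR_ge0 ?expR_ge0//.
  rewrite powR_mulrn ?mulr_ge0 ?powR_ge0 ?expR_ge0//.
  rewrite -EFinM exprMn -/c -expRM_natl -expR_sum; congr (_ * expR _)%:E.
  rewrite /dot -sumrN mulr_suml mulr_sumr; apply: eq_bigr => i _.
  by rewrite !mxE; field; rewrite gt_eqF.
under eq_integral do rewrite rE.
have mg i : measurable_fun [set: measurableTypeR R] (g i).
  apply: measurableT_comp => //; apply: measurable_funM => //.
  apply: measurableT_comp => //; apply: measurable_funX.
  exact: measurable_funB.
rewrite ge0_integralZl//; last 3 first.
- by apply/measurable_EFinP; exact: measurable_rV_prod.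
- by move=> u _; rewrite lee_fin prodr_ge0// => i _; exact: expR_ge0.
- by rewrite lee_fin sqr_ge0.
rewrite integral_rV_prod//; last by move=> i s; exact: expR_ge0.
suff /andP[P0 Poo] : (0 <= \prod_(i < n) \int[@lebesgue_measure R]_s (g i s)%:E < +oo)%E.
  by apply: lte_mul_pinfty => //; rewrite lee_fin sqr_ge0.
elim/big_rec : _ => [|i e _ /andP[e0 eoo]]; first by rewrite lee_fin ler01 ltry.
have g0 : (0 <= \int[@lebesgue_measure R]_s (g i s)%:E)%E.
  by apply: integral_ge0 => s _; rewrite lee_fin expR_ge0.
rewrite mule_ge0//=; apply: lte_mul_pinfty => //.
by rewrite ge0_fin_numE//; exact: integral_gauss_lty.
Qed.

Definition coherent h X : L2 R n := cL2_of (CL2fun (coherent_fun_L2 h X)).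

Definition wick h (A : L2 R n -> L2 R n) X : R[i] :=
  cL2_inner (A (coherent h X)) (coherent h X).

Definition berezin h (A : L2 R n -> L2 R n) (XY : phase R n * phase R n) : R[i] :=
  cL2_inner (A (coherent h XY.1)) (coherent h XY.2)
  / cL2_inner (coherent h XY.1) (coherent h XY.2).

(* The supremum is taken in [0, +oo]; it is finite when A is bounded. *)
Definition confinement h (A : L2 R n -> L2 R n) (V : phase R n) : \bar R :=
  ereal_sup [set (normc (cL2_inner (A (coherent h XY.1)) (coherent h XY.2)))%:E
            | XY in [set XY : phase R n * phase R n | XY.1 - XY.2 = V]].

Definition Ch h : set {linear L2 R n -> L2 R n} :=
  [set A | cL2_bounded A /\
    (lebesgue_rV R n \x lebesgue_rV R n)%E.-integrable
      [set: phase R n] (confinement h A)].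

Definition norm2_phase X : R := dot X.1 X.1 + dot X.2 X.2.

End coherent.

(* Directional derivatives of a complex-valued function on a real space. *)
Section cderive.
Variables (R : realType) (V : normedModType R).
Implicit Types (f : V -> R[i]) (p v : V).

Definition cderivable f p v : Prop :=
  derivable (fun q => complex.Re (f q) : R^o) p v /\
  derivable (fun q => complex.Im (f q) : R^o) p v.

Definition cderive f p v : R[i] :=
  'D_v (fun q => complex.Re (f q) : R^o) p +i*
  'D_v (fun q => complex.Im (f q) : R^o) p.

End cderive.

(* The coordinate directions in R^{4n}, with points (X, Y) = ((x, xi), (y, eta)). *)
Section directions.
Variables (R : realType) (n : nat).
Implicit Type j : 'I_n.

Let e j : 'rV[R]_n := delta_mx ord0 j.

Definition dir_x j : phase R n * phase R n := ((e j, 0), (0, 0)).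
Definition dir_xi j : phase R n * phase R n := ((0, e j), (0, 0)).
Definition dir_y j : phase R n * phase R n := ((0, 0), (e j, 0)).
Definition dir_eta j : phase R n * phase R n := ((0, 0), (0, e j)).

End directions.

(* Main.v *)
From HB Require Import structures.
Require Import Defs.
From mathcomp Require Import all_boot all_order all_algebra.
From mathcomp Require Import all_classical all_reals all_analysis.
From mathcomp Require Import measurable_realfun complex ring lra.

(** Up to the scalar [coherent_factor], which cancels in the Berezin symbol,
the coherent state at X = (x, xi) is the Gaussian exponential
E_X(u) = exp (- |u|^2 / 2h + u.(x + i xi) / h), which is holomorphic in
x + i xi. Hence the Berezin symbol is the quotient of <A E_X, E_Y> by
<E_X, E_Y>, and all comes down to two facts.

First, X |-> E_X is differentiable in L^2 along every direction (a, 0) and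
(0, a), the second derivative being i times the first ([gaussv_taylor1]): the
second-order remainder of exp (t u.a / h) and of exp (i t u.a / h) is at most
8 t^2 exp (2 |u.a| / h), and the product of E_X with exp (+- 2 u.a / h) has the
modulus of E_(x +- 2a, 0), again square integrable. Consequently L(E_X)
satisfies the Cauchy-Riemann equations for every bounded linear functional L
([is_cderive_gaussv]). With L = <A . , E_Y>, with the conjugate of
<A E_X, . >, and with the same forms for A = id, this gives (i) by the
quotient rule, as soon as <E_X, E_Y> does not vanish.

Second, <E_X, E_Y> is explicit. It only depends on Z = (x + y, xi - eta), and
is the integral of exp (- |u|^2 / h + u.(z + i zeta) / h), Z = (z, zeta).
Translating u by z / 2 extracts the dependence on z
([gauss_laplace_translate]). The resulting formula gives the derivative of the
integral along real directions, and the Cauchy-Riemann equations just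
established turn it into the differential equation
g'(t) = - t |zeta|^2 / (2h) g(t) along t |-> (0, t zeta)
([gauss_laplace_imag]), in place of a contour shift. The value at 0 is the
classical Gaussian integral. The coherent states are therefore of norm 1, which
is (ii), and |<Psi_X, Psi_Y>| = exp (- |X - Y|^2 / 4h), from which (iii) follows
by the definition of the supremum. *)

Set Implicit Arguments.
Unset Strict Implicit.
Unset Printing Implicit Defensive.

Import Order.TTheory GRing.Theory Num.Theory.
Import Normc numFieldNormedType.Exports.

Local Open Scope classical_set_scope.
Local Open Scope ring_scope.
Local Open Scope complex_scope.
Local Notation Re := complex.Re.
Local Notation Im := complex.Im.

(** * Derivatives of complex-valued functions *)

Section complex_calculus.
Variable R : realType.

Lemma normc_leRI (z : R[i]) : normc z <= `|Re z| + `|Im z|.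
Proof.
case: z => a b /=.
rewrite -[leRHS]ger0_norm ?addr_ge0// -sqrtr_sqr ler_wsqrtr//.
rewrite sqrrD !real_normK ?num_real// -addrA lerD2l lerDr.
by rewrite mulrn_wge0// mulr_ge0.
Qed.

Lemma Re_le_normc (z : R[i]) : `|Re z| <= normc z.
Proof. by case: z => a b /=; rewrite -sqrtr_sqr ler_wsqrtr// lerDl sqr_ge0. Qed.

Lemma Im_le_normc (z : R[i]) : `|Im z| <= normc z.
Proof. by case: z => a b /=; rewrite -sqrtr_sqr ler_wsqrtr// lerDr sqr_ge0. Qed.

Lemma normc_conj (z : R[i]) : normc z^* = normc z.
Proof. by case: z => a b /=; rewrite sqrrN. Qed.

Lemma conjcM (z w : R[i]) : conjc (z * w) = conjc z * conjc w.
Proof. exact: rmorphM. Qed.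

Lemma normc_real (r : R) : normc r%:C = `|r|.
Proof. by rewrite /= expr0n/= addr0 sqrtr_sqr. Qed.

(** The form in which estimates in the L^2 norm, quadratic in the step, become
derivatives. *)
Lemma is_derive_sqr_remainder (V : normedModType R) (f : V -> R) p v d C :
  (forall t : R, `|t| <= 1 -> `|f (t *: v + p) - f p - t * d| <= C * t ^+ 2) ->
  is_derive p v (f : V -> R^o) d.
Proof.
move=> fC.
have C0 : 0 <= C.
  by have := fC 1; rewrite normr1 expr1n mulr1 => /(_ (lexx _)); exact: le_trans.
have cvg_d : (fun t => t^-1 *: (((f : V -> R^o) \o shift p) (t *: v) - f p))
    @ 0^' --> (d : R^o).
  apply/cvgrPdist_le => e e0; near=> t.
  have t0 : t != 0 by near: t; exact: nbhs_dnbhs_neq.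
  have t1 : `|t| <= 1 by near: t; apply: dnbhs0_le.
  have te : `|t| <= e / (C + 1).
    by near: t; apply: dnbhs0_le; rewrite divr_gt0// ltr_wpDl.
  have -> : d - t^-1 *: (f (t *: v + p) - f p : R^o) =
      - (t^-1 * (f (t *: v + p) - f p - t * d)).
    by rewrite [_ *: _]mulrC; field.
  rewrite normrN normrM normfV ler_pdivrMl ?normr_gt0// (le_trans (fC _ t1))//.
  rewrite -[t ^+ 2]real_normK ?num_real// expr2 mulrCA ler_wpM2l//.
  apply: (@le_trans _ _ ((C + 1) * `|t|)).
    by rewrite ler_wpM2r// lerDl.
  by rewrite mulrC -ler_pdivlMr// ltr_wpDl.
apply: DeriveDef; first by apply/cvg_ex; exists d.
exact: cvg_lim cvg_d.
Unshelve. all: by end_near. Qed.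

(** Existence and value in one statement, so that both travel together through
the product and quotient rules. *)
Definition is_cderive (V : normedModType R) (f : V -> R[i]) p v (d : R[i]) :=
  is_derive p v (fun q => Re (f q) : R^o) (Re d) /\
  is_derive p v (fun q => Im (f q) : R^o) (Im d).

Section theory.
Variable V : normedModType R.
Implicit Types (f g : V -> R[i]) (p v : V) (d e : R[i]).

Lemma is_cderive_cderivable f p v d : is_cderive f p v d -> cderivable f p v.
Proof. by move=> [[]? _ []? _]; split. Qed.

Lemma is_cderive_val f p v d : is_cderive f p v d -> cderive f p v = d.
Proof. by case: d => a b [[_ /= rd] [_ /= id]]; rewrite /cderive rd id. Qed.

Lemma is_cderive_sqr_remainder f p v d C :
  (forall t : R, `|t| <= 1 ->
    normc (f (t *: v + p) - f p - t%:C * d) <= C * t ^+ 2) ->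
  is_cderive f p v d.
Proof.
move=> fC; split; apply: (is_derive_sqr_remainder (C := C)) => t /fC;
  apply: le_trans.
- apply: le_trans (Re_le_normc _).
  by case: (f (t *: v + p)) (f p) d {fC} => [? ?] [? ?] [? ?] /=; simpc.
- apply: le_trans (Im_le_normc _).
  by case: (f (t *: v + p)) (f p) d {fC} => [? ?] [? ?] [? ?] /=; simpc.
Qed.

(** A directional derivative only sees the restriction to a line, so it can be
transported between functions on different spaces: this is used to freeze one
of the two phase-space points, and to pass to functions of one real variable. *)
Lemma is_cderive_line (W : normedModType R) f p v (g : W -> R[i]) q w d :
  (forall t : R, f (t *: v + p) = g (t *: w + q)) ->
  is_cderive g q w d -> is_cderive f p v d.
Proof.
move=> fg.
have fgp : f p = g q by have := fg 0; rewrite !scale0r !add0r.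
move=> [[/= rd rE] [/= id iE]]; split; apply: DeriveDef.
- move: rd; rewrite /derivable/= -fgp.
  by under eq_fun do rewrite -fg.
- by rewrite -rE /derive/= -fgp; under [in RHS]eq_fun do rewrite -fg.
- move: id; rewrite /derivable/= -fgp.
  by under eq_fun do rewrite -fg.
- by rewrite -iE /derive/= -fgp; under [in RHS]eq_fun do rewrite -fg.
Qed.

Lemma is_cderiveM f g p v d e : is_cderive f p v d -> is_cderive g p v e ->
  is_cderive (fun q => f q * g q) p v (d * g p + f p * e).
Proof.
move=> [rf jf] [rg jg]; split.
- have ReE (a b a' b' x y z w : R) : a * z + a' * x - (b * w + b' * y) =
    x * a' - y * b' + (a * z - b * w) by ring.
  have := is_deriveB (is_deriveM rf rg) (is_deriveM jf jg).
  congr is_derive.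
    by apply/funext => q; rewrite !fctE; case: (f q) (g q) => [? ?] [? ?].
  case: (f p) (g p) d e {rf jf rg jg} => [? ?] [? ?] [? ?] [? ?] /=; exact: ReE.
- have ImE (a b a' b' x y z w : R) : a * w + b' * x + (b * z + a' * y) =
    x * b' + y * a' + (a * w + b * z) by ring.
  have := is_deriveD (is_deriveM rf jg) (is_deriveM jf rg).
  congr is_derive.
    by apply/funext => q; rewrite !fctE; case: (f q) (g q) => [? ?] [? ?].
  case: (f p) (g p) d e {rf jf rg jg} => [? ?] [? ?] [? ?] [? ?] /=; exact: ImE.
Qed.

Lemma is_cderiveV g p v e : g p != 0 -> is_cderive g p v e ->
  is_cderive (fun q => (g q)^-1) p v (- e * ((g p)^-1 * (g p)^-1)).
Proof.
move=> g0 [rg jg].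
pose a : V -> R^o := fun q => Re (g q).
pose b : V -> R^o := fun q => Im (g q).
pose n2 : V -> R^o := a * a + b * b.
have n20 : n2 p != 0.
  rewrite /n2 !fctE -!expr2 paddr_eq0 ?sqr_ge0// !sqrf_eq0.
  by move: g0; rewrite eq_complex.
have [dn2 n2E'] := is_deriveD (is_deriveM rg rg) (is_deriveM jg jg).
have Dn2V : is_derive p v (fun q => (n2 q)^-1 : R^o)
    (- (n2 p) ^- 2 *: (Re (g p) *: Re e + Re (g p) *: Re e +
                       (Im (g p) *: Im e + Im (g p) *: Im e))).
  by apply: DeriveDef; [exact: derivableV|rewrite deriveV// n2E'].
have n2E q : n2 q = Re (g q) ^+ 2 + Im (g q) ^+ 2 by rewrite /n2 !fctE -!expr2.
(* The two components of - e / g^2, over the common denominator |g|^4. *)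
have inv_sqr (x y z w : R) : x ^+ 2 + y ^+ 2 != 0 ->
    x * (- (x ^+ 2 + y ^+ 2) ^- 2 * (x * z + x * z + (y * w + y * w)))
      + (x ^+ 2 + y ^+ 2)^-1 * z
    = Re (- (z +i* w) * ((x +i* y)^-1 * (x +i* y)^-1)) /\
    - (y * (- (x ^+ 2 + y ^+ 2) ^- 2 * (x * z + x * z + (y * w + y * w)))
      + (x ^+ 2 + y ^+ 2)^-1 * w)
    = Im (- (z +i* w) * ((x +i* y)^-1 * (x +i* y)^-1)).
  by move=> xy0; simpc => /=; split; field.
split.
- have := is_deriveM rg Dn2V; congr is_derive.
    by apply/funext => q; rewrite !fctE n2E /a; case: (g q).
  move: n20; rewrite n2E; case: (g p) e {rg jg Dn2V dn2 n2E' g0} => [x y] [z w] /=.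
  by move=> /inv_sqr-/(_ z w)[+ _].
- have := is_deriveN (is_deriveM jg Dn2V); congr is_derive.
    by apply/funext => q; rewrite !fctE n2E /b; case: (g q).
  move: n20; rewrite n2E; case: (g p) e {rg jg Dn2V dn2 n2E' g0} => [x y] [z w] /=.
  by move=> /inv_sqr-/(_ z w)[_ +].
Qed.

Lemma is_cderive_div f g p v d e : g p != 0 ->
  is_cderive f p v d -> is_cderive g p v e ->
  is_cderive (fun q => f q / g q) p v ((d * g p - f p * e) / g p ^+ 2).
Proof.
move=> g0 df dg.
have := is_cderiveM df (is_cderiveV g0 dg); congr is_cderive.
by field.
Qed.

End theory.
End complex_calculus.

(** * Translation invariance of Lebesgue measure *)

Section translation.
Variable R : realType.
Notation mu1 := (@lebesgue_measure R).

Let shift1 (a : R) (x : measurableTypeR R) : measurableTypeR R := x + a.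

Let measurable_shift1 a : measurable_fun setT (shift1 a).
Proof. exact: measurable_funD. Qed.

Lemma lebesgue_measure_translate (a : R) (A : set (measurableTypeR R)) :
  measurable A -> mu1 ((fun x => x + a) @^-1` A) = mu1 A.
Proof.
move=> mA; apply/esym.
apply: (lebesgue_measure_unique (mu := pushforward mu1 (shift1 a))) => //.
move=> _ [[x y] _ <-] /=; rewrite /pushforward.
have -> : shift1 a @^-1` `]x, y] = `](x - a), (y - a)]%classic.
  by apply/seteqP; split => t /=; rewrite !in_itv /shift1/= ltrBlDr lerBrDr.
rewrite !lebesgue_measure_itv/= !lte_fin ltrD2r; case: ifP => // _.
by rewrite -!EFinB; congr EFin; ring.
Qed.

Lemma measurable_rV_shift n (a : 'rV[R]_n) :
  measurable_fun setT (fun u : 'rV[R]_n => u + a).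
Proof.
apply: measurable_fun_rVP => i.
rewrite (_ : _ \o _ = fun u => rV_coord i u + a ord0 i); last first.
  by apply/funext => u; rewrite /rV_coord/= mxE.
by apply: measurable_funD => //; exact: measurable_rV_coord.
Qed.

(** By uniqueness of the product measure: in dimension n.+1 the translated
measure gives boxes X * Y the product of the translated measures of X and Y. *)
Lemma lebesgue_rV_translate n (a : 'rV[R]_n) (A : set 'rV[R]_n) :
  measurable A -> lebesgue_rV R n ((fun u => u + a) @^-1` A) = lebesgue_rV R n A.
Proof.
elim: n a A => [|n IHn] a A mA.
  by congr (lebesgue_rV R 0 _); apply/funext => u /=; rewrite [u + a]thinmx0 [u]thinmx0.
pose nu := lebesgue_rV R n.
pose a0 := a ord0 ord0; pose a' : 'rV_n := \row_i a ord0 (lift ord0 i).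
pose sh (p : measurableTypeR R * 'rV[R]_n) := (shift1 a0 p.1, p.2 + a').
have msh : measurable_fun setT sh.
  apply: measurable_fun_pair.
    by apply: measurableT_comp; [exact: measurable_shift1|].
  by apply: (measurableT_comp (measurable_rV_shift a')).
have mB : measurable (@rV_cons R n @^-1` A).
  by rewrite -[X in measurable X]setTI; exact: measurable_rV_cons.
rewrite /= /lebesgue_rVS /pushforward.
have -> : @rV_cons R n @^-1` ((fun u => u + a) @^-1` A) =
    sh @^-1` (@rV_cons R n @^-1` A).
  apply/funext => p /=; congr A; apply/rowP => i; rewrite mxE.
  case: (unliftP ord0 i) => [j|] ->; rewrite ?rV_cons0 ?rV_consS//.
  by rewrite !mxE.
apply/esym.
apply: (product_measure_unique (m' := pushforward (mu1 \x nu)%E sh)) => //.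
move=> X Y mX mY; rewrite -[LHS]/((mu1 \x nu)%E (sh @^-1` (X `*` Y))).
have -> : sh @^-1` (X `*` Y) =
    ((fun x => x + a0) @^-1` X) `*` ((fun u => u + a') @^-1` Y) by [].
have mX0 : measurable ((fun x : measurableTypeR R => x + a0) @^-1` X).
  by rewrite -[X in measurable X]setTI; exact: measurable_shift1.
have mYa : measurable ((fun u => u + a') @^-1` Y).
  by rewrite -[X in measurable X]setTI; exact: measurable_rV_shift.
by rewrite product_measure1E//; congr (_ * _)%E;
  [exact: lebesgue_measure_translate|exact: IHn].
Qed.

(** Taking positive and negative parts commutes with translations, which reduces
the claim to nonnegative functions. *)
Lemma integral_rV_translate n (a : 'rV[R]_n) (f : 'rV[R]_n -> \bar R) :
  measurable_fun setT f ->
  (\int[lebesgue_rV R n]_u f (u + a)%R = \int[lebesgue_rV R n]_u f u)%E.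
Proof.
have ge0 (g : 'rV[R]_n -> \bar R) : measurable_fun setT g ->
    (forall u, (0 <= g u)%E) ->
    (\int[lebesgue_rV R n]_u g (u + a)%R = \int[lebesgue_rV R n]_u g u)%E.
  move=> mg g0.
  have := @ge0_integral_pushforward _ _ _ _ R _ (measurable_rV_shift a)
    (lebesgue_rV R n) setT g measurableT mg (fun u _ => g0 u).
  rewrite preimage_setT => <-.
  apply: eq_measure_integral; first exact: measurable_rV_shift.
  by move=> mS B mB _; exact: lebesgue_rV_translate.
move=> mf; rewrite integralE [RHS]integralE; congr (_ - _)%E.
- rewrite -[RHS]ge0; first by apply: eq_integral => u _; rewrite !funeposE.
    exact: measurable_funepos.
  by move=> u; exact: funepos_ge0.
- rewrite -[RHS]ge0; first by apply: eq_integral => u _; rewrite !funenegE.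
    exact: measurable_funeneg.
  by move=> u; exact: funeneg_ge0.
Qed.

End translation.

(** * The inner product of L^2 *)

Section L2_inner_product.
Context d (T : measurableType d) (R : realType) (mu : {measure set T -> \bar R}).
Implicit Types (f g : cL2fun mu) (p q r : cL2 mu).

Definition cintegrable (f : T -> R[i]) : Prop :=
  mu.-integrable setT (EFin \o (fun u => Re (f u))) /\
  mu.-integrable setT (EFin \o (fun u => Im (f u))).

Lemma cL2fun_cmeasurable f : cmeasurable f.
Proof. by have /asboolP[] := cL2funP f. Qed.

Lemma cL2fun_normc_Lfun f : (fun u => normc (f u)) \in Lfun mu 2%:E.
Proof.
have /asboolP[mf lf] := cL2funP f.
by rewrite inE; apply/andP; split; rewrite inE//; exact: measurable_normc.
Qed.

Lemma cmeasurable_mul_conj (f g : T -> R[i]) :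
  cmeasurable f -> cmeasurable g -> cmeasurable (fun u => f u * (g u)^*).
Proof.
move=> [rf jf] [rg jg]; split.
- rewrite (_ : (fun _ => _) = fun u => Re (f u) * Re (g u) + Im (f u) * Im (g u)).
    by apply: measurable_funD; exact: measurable_funM.
  by apply/funext => u; case: (f u) (g u) => [? ?] [? ?]; simpc => /=; ring.
- rewrite (_ : (fun _ => _) = fun u => Im (f u) * Re (g u) - Re (f u) * Im (g u)).
    by apply: measurable_funB; exact: measurable_funM.
  by apply/funext => u; case: (f u) (g u) => [? ?] [? ?]; simpc => /=; ring.
Qed.

Lemma integrable_normc_mul f g :
  mu.-integrable setT (EFin \o (fun u => normc (f u) * normc (g u))).
Proof.
by apply/Lfun1_integrable; apply: Lfun2_mul_Lfun1; exact: cL2fun_normc_Lfun.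
Qed.

Lemma cintegrable_mul_conj f g : cintegrable (fun u => f u * (g u)^*).
Proof.
have [mr mi] := cmeasurable_mul_conj (cL2fun_cmeasurable f) (cL2fun_cmeasurable g).
have fgE u : normc (f u) * normc (g u) = normc (f u * (g u)^*).
  by rewrite normcM normc_conj.
split; apply: le_integrable (integrable_normc_mul f g) => //=.
- exact/measurable_EFinP.
- move=> u _; rewrite lee_fin fgE (le_trans (Re_le_normc _))//.
  exact: ler_norm.
- exact/measurable_EFinP.
- move=> u _; rewrite lee_fin fgE (le_trans (Im_le_normc _))//.
  exact: ler_norm.
Qed.

Lemma ae_eq_cintegral (f g : T -> R[i]) : cmeasurable f -> cmeasurable g ->
  {ae mu, forall u, f u = g u} -> cintegral mu f = cintegral mu g.
Proof.
move=> [rf jf] [rg jg] fg; rewrite /cintegral /Rintegral.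
congr (fine _ +i* fine _); apply: ae_eq_integral => //.
- exact/measurable_EFinP.
- exact/measurable_EFinP.
- by apply: filterS fg => u /= -> .
- exact/measurable_EFinP.
- exact/measurable_EFinP.
- by apply: filterS fg => u /= -> .
Qed.

Lemma cintegralD (f g : T -> R[i]) : cintegrable f -> cintegrable g ->
  cintegral mu (fun u => f u + g u) = cintegral mu f + cintegral mu g.
Proof.
move=> [rf jf] [rg jg]; rewrite /cintegral; simpc.
rewrite -!RintegralD//; congr (_ +i* _); apply: eq_Rintegral => u _;
  by case: (f u) (g u) => [? ?] [? ?].
Qed.

Lemma cintegralZ (c : R[i]) (f : T -> R[i]) : cintegrable f ->
  cintegral mu (fun u => c * f u) = c * cintegral mu f.
Proof.
case: c => a b [rf jf]; rewrite /cintegral; simpc.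
have intZ k (h : T -> R) : mu.-integrable setT (EFin \o h) ->
    mu.-integrable setT (EFin \o (fun u => k * h u)).
  by move=> ih; apply: eq_integrable (integrableZl _ k ih).
rewrite -!RintegralZl// -RintegralB//; try exact: intZ.
rewrite -RintegralD//; try exact: intZ.
by congr (_ +i* _); apply: eq_Rintegral => u _; case: (f u) => ? ?.
Qed.

Lemma cintegral_conj (f : T -> R[i]) : cintegrable f ->
  cintegral mu (fun u => (f u)^*) = (cintegral mu f)^*.
Proof.
move=> [rf jf]; rewrite /cintegral /=; congr (_ +i* _).
  by apply: eq_Rintegral => u _; case: (f u).
rewrite -mulN1r -RintegralZl//; apply: eq_Rintegral => u _.
by rewrite mulN1r; case: (f u).
Qed.

Lemma cL2_ofB f g : cL2_of f - cL2_of g = cL2_of (f - g).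
Proof. by apply/eqP; rewrite subr_eq cL2_ofD subrK. Qed.

(** Classes in L^2 can be handled through any representatives. *)
Lemma cL2_inner_of f g :
  cL2_inner (cL2_of f) (cL2_of g) = cintegral mu (fun u => f u * (g u)^*).
Proof.
apply: ae_eq_cintegral.
- exact: cmeasurable_mul_conj (cL2fun_cmeasurable _) (cL2fun_cmeasurable _).
- exact: cmeasurable_mul_conj (cL2fun_cmeasurable _) (cL2fun_cmeasurable _).
- by apply: filterS2 (cL2_reprK f) (cL2_reprK g) => u /= -> ->.
Qed.

Lemma cL2_inner_linear (c : R[i]) p q r :
  cL2_inner (c *: p + q) r = c * cL2_inner p r + cL2_inner q r.
Proof.
rewrite -[p]cL2_ofK -[q]cL2_ofK -[r]cL2_ofK.
set f := repr p; set g := repr q; set k := repr r.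
rewrite [c *: _]cL2_ofZ cL2_ofD !cL2_inner_of -cintegralZ; last first.
  exact: cintegrable_mul_conj.
rewrite -cintegralD.
- congr cintegral; apply/funext => u.
  by rewrite [(_ + _ : cL2fun mu) u](_ : _ = c * f u + g u)// mulrDl mulrA.
- have := cintegrable_mul_conj (cL2fun_scale c f) k.
  by congr cintegrable; apply/funext => u /=; rewrite mulrA.
- exact: cintegrable_mul_conj.
Qed.

Lemma cL2_inner_conj p q : cL2_inner p q = (cL2_inner q p)^*.
Proof.
rewrite -[p]cL2_ofK -[q]cL2_ofK !cL2_inner_of -cintegral_conj; last first.
  exact: cintegrable_mul_conj.
congr cintegral; apply/funext => u.
by case: (repr p u) (repr q u) => [? ?] [? ?] /=; simpc; congr (_ +i* _); ring.
Qed.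

Lemma cL2_innerZl (c : R[i]) p q : cL2_inner (c *: p) q = c * cL2_inner p q.
Proof.
have inner0 : cL2_inner (0 : cL2 mu) q = 0.
  have := cL2_inner_linear (-1) 0 (0 : cL2 mu) q.
  by rewrite scaler0 addr0 mulN1r addNr.
by rewrite -[c *: p]addr0 cL2_inner_linear inner0 addr0.
Qed.

Lemma cL2_innerZr (c : R[i]) p q :
  cL2_inner p (c *: q) = conjc c * cL2_inner p q.
Proof. by rewrite cL2_inner_conj cL2_innerZl conjcM -cL2_inner_conj. Qed.

Lemma integrable_normc_sqr f :
  mu.-integrable setT (EFin \o (fun u => normc (f u) ^+ 2)).
Proof. exact: integrable_normc_mul. Qed.

Lemma cL2_normE f : cL2_norm (cL2_of f) = Num.sqrt (\int[mu]_u normc (f u) ^+ 2).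
Proof.
have mn (k : cL2fun mu) : measurable_fun setT (fun u => (normc (k u) ^+ 2)%:E).
  apply/measurable_EFinP; apply: measurable_funX.
  exact/measurable_normc/cL2fun_cmeasurable.
rewrite /cL2_norm unlock.
have -> : (\int[mu]_u `|(EFin \o (fun v => normc (cL2_repr (cL2_of f) v))) u| `^ 2 =
    \int[mu]_u (normc (f u) ^+ 2)%:E)%E.
  rewrite (eq_integral (fun u => (normc (cL2_repr (cL2_of f) u) ^+ 2)%:E)); last first.
    by move=> u _ /=; rewrite ger0_norm ?normc_ge0// powR_mulrn// normc_ge0.
  apply: ae_eq_integral => //; first exact: (mn (repr (cL2_of f))).
  by apply: filterS (cL2_reprK f) => u /= ->.
rewrite -[X in (X `^ _)%E](@fineK R); last first.
  exact: (integrable_fin_num measurableT (integrable_normc_sqr f)).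
rewrite poweR_EFin/= powR12_sqrt// fine_ge0// integral_ge0// => u _.
by rewrite lee_fin sqr_ge0.
Qed.

Lemma cL2_norm_ge0 p : 0 <= cL2_norm p.
Proof. by rewrite -[p]cL2_ofK cL2_normE sqrtr_ge0. Qed.

Lemma le_cL2_norm (C : R) f g : 0 <= C ->
  (forall u, normc (f u) <= C * normc (g u)) ->
  cL2_norm (cL2_of f) <= C * cL2_norm (cL2_of g).
Proof.
move=> C0 fg; rewrite !cL2_normE -[C in leRHS]ger0_norm// -sqrtr_sqr.
rewrite -sqrtrM ?sqr_ge0// ler_wsqrtr// -RintegralZl//; last first.
  exact: integrable_normc_sqr.
apply: le_Rintegral => //; first exact: integrable_normc_sqr.
  by apply: eq_integrable (integrableZl _ (C ^+ 2) (integrable_normc_sqr g)).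
move=> u _; rewrite -exprMn ler_sqr ?nnegrE ?mulr_ge0 ?normc_ge0//.
Qed.

(** The constant 2 comes from bounding the real and imaginary parts
separately; only continuity of the inner product matters in what follows. *)
Lemma normc_cL2_inner_le p q : normc (cL2_inner p q) <= 2 * (cL2_norm p * cL2_norm q).
Proof.
have mn (k : cL2fun mu) : measurable_fun setT (fun u => normc (k u)).
  exact/measurable_normc/cL2fun_cmeasurable.
have hold : \int[mu]_u (normc (repr p u) * normc (repr q u)) <= cL2_norm p * cL2_norm q.
  have := hoelder mu (mn (repr p)) (mn (repr q)) (ltr0n _ 2) (ltr0n _ 2).
  have -> : 2^-1 + 2^-1 = 1 :> R by lra.
  move=> /(_ erefl); rewrite Lnorm1.
  have fin (k : cL2fun mu) :
      ('N[mu]_2%:E[EFin \o (fun u => normc (k u))] \is a fin_num)%E.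
    rewrite ge0_fin_numE ?Lnorm_ge0//.
    by have /asboolP[] := cL2funP k.
  move=> /fine_le; rewrite fineM// => /(_ _ _)/= H.
  apply: le_trans (H _ _).
  - rewrite /Rintegral le_eqVlt; apply/orP; left; apply/eqP; congr fine.
    by apply: eq_integral => u _ /=; rewrite ger0_norm// mulr_ge0 ?normc_ge0.
  - rewrite (eq_integral (EFin \o (fun u => normc (repr p u) * normc (repr q u)))).
      exact: (integrable_fin_num measurableT (integrable_normc_mul _ _)).
    by move=> u _ /=; rewrite ger0_norm// mulr_ge0 ?normc_ge0.
  - by rewrite fin_numM.
have ineq (k : T -> R) : mu.-integrable setT (EFin \o k) ->
    (forall u, `|k u| <= normc (repr p u) * normc (repr q u)) ->
    `|\int[mu]_u k u| <= cL2_norm p * cL2_norm q.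
  move=> ik kpq; apply: le_trans hold.
  apply: le_trans (le_normr_Rintegral _ ik) _ => //.
  apply: le_Rintegral => //; last exact: integrable_normc_mul.
  exact: (integrable_norm ik).
have [ri ii] := cintegrable_mul_conj (repr p) (repr q).
rewrite (le_trans (normc_leRI _))// mulr_natl mulr2n lerD//; apply: ineq => // u.
- by rewrite (le_trans (Re_le_normc _))// normcM normc_conj.
- by rewrite (le_trans (Im_le_normc _))// normcM normc_conj.
Qed.

End L2_inner_product.

(** * Second-order estimates of the exponential *)

Section cexp_theory.
Variable R : realType.
Implicit Types (z w : R[i]) (r : R).

Lemma cexpD z w : cexp (z + w) = cexp z * cexp w.
Proof.
case: z w => [a b] [c d]; rewrite /cexp /= expRD cosD sinD; simpc.
by congr (_ +i* _); ring.
Qed.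

Lemma cexpE (a b : R) : cexp (a +i* b) = (expR a * cos b) +i* (expR a * sin b).
Proof. by rewrite /cexp; simpc. Qed.

Lemma cexp_real r : cexp r%:C = (expR r)%:C.
Proof. by rewrite cexpE cos0 sin0 mulr1 mulr0. Qed.

Lemma cexp0 : cexp 0 = 1 :> R[i].
Proof. by rewrite (cexp_real 0) expR0. Qed.

Lemma normc_cexp z : normc (cexp z) = expR (Re z).
Proof.
case: z => a b; rewrite /cexp normcM normc_real ger0_norm ?expR_ge0//=.
by rewrite cos2Dsin2 sqrtr1 mulr1.
Qed.

Lemma cexp_neq0 z : cexp z != 0.
Proof.
apply/eqP => /(congr1 (@normc R)); rewrite normc_cexp normc0 => /eqP.
by rewrite gt_eqF// expR_gt0.
Qed.

Lemma cexp_conj z : (cexp z)^* = cexp z^*.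
Proof. by case: z => a b; rewrite /= !cexpE cosN sinN mulrN; simpc. Qed.

(** The mean value inequality at 0, applied twice in each of the second-order
estimates below. *)
Lemma norm_sub0_le (f df : R -> R) r (K : R) :
  (forall x : R, is_derive x 1 f (df x)) ->
  (forall x, `|x| <= `|r| -> `|df x| <= K) -> `|f r - f 0| <= K * `|r|.
Proof.
move=> Df dfK.
have cf (a b : R) : {within `[a, b], continuous f}.
  apply: derivable_within_continuous => x _.
  exact: ex_derive.
have [r0|r0] := leP 0 r.
  have [c /[!in_itv]/= /andP[c0 cr] ->] := MVT_segment r0 (fun x _ => Df x) (cf _ _).
  by rewrite subr0 normrM ler_wpM2r// dfK// !ger0_norm.
have [c /[!in_itv]/= /andP[cr c0] E] :=
  MVT_segment (ltW r0) (fun x _ => Df x) (cf _ _).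
rewrite distrC E sub0r normrM normrN ler_wpM2r// dfK// !ler0_norm ?lerN2//.
exact: ltW.
Qed.

Lemma expR_taylor1 r : `|expR r - 1 - r| <= r ^+ 2 * expR `|r|.
Proof.
have exp_le x : `|x| <= `|r| -> expR x <= expR `|r|.
  by move=> xr; rewrite ler_expR (le_trans (ler_norm _)).
have exp1 x : `|x| <= `|r| -> `|expR x - 1| <= expR `|r| * `|r|.
  move=> xr; rewrite -expR0.
  apply: (@le_trans _ _ (expR `|r| * `|x|)); last by rewrite ler_wpM2l ?expR_ge0.
  apply: (norm_sub0_le (df := expR)) => y yx.
  by rewrite ger0_norm ?expR_ge0// exp_le// (le_trans yx).
have := norm_sub0_le (f := @expR R \- id) (df := fun x : R => expR x - 1) _ exp1.
rewrite /= expR0 subr0 => H.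
have -> : expR r - 1 - r = expR r - r - 1 by ring.
by rewrite (le_trans (H _))// -mulrA -expr2 real_normK ?num_real// mulrC.
Qed.

Lemma cos_taylor1 r : `|cos r - 1| <= r ^+ 2.
Proof.
have sin_le (x : R) : `|sin x| <= `|x|.
  have := norm_sub0_le (f := @sin R) (r := x) (K := 1) (df := @cos R).
  by rewrite sin0 subr0 mul1r; apply => y _; exact: cos_max.
have := norm_sub0_le (f := @cos R) (r := r) (K := `|r|) (df := fun x : R => - sin x).
rewrite cos0 -expr2 real_normK ?num_real//; apply => x xr.
by rewrite normrN (le_trans (sin_le _)).
Qed.

Lemma sin_taylor1 r : `|sin r - r| <= r ^+ 2.
Proof.
have cos_le (x : R) : `|cos x - 1| <= `|x|.
  have := norm_sub0_le (f := @cos R) (r := x) (K := 1) (df := fun x : R => - sin x).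
  by rewrite cos0 mul1r; apply => y _; rewrite normrN sin_max.
have := norm_sub0_le (f := @sin R \- id) (r := r) (K := `|r|)
  (df := fun x : R => cos x - 1).
rewrite /= sin0 !subr0 -expr2 real_normK ?num_real//; apply => x xr.
by rewrite (le_trans (cos_le _)).
Qed.

(** The complex unit carried by a phase-space direction: moving x (false)
multiplies the infinitesimal variation of x + i xi by 1, moving xi (true)
multiplies it by i. *)
Definition dir_unit (b : bool) : R[i] := if b then 'i%C else 1.

Lemma cexp_taylor1 b r :
  normc (cexp (dir_unit b * r%:C) - 1 - dir_unit b * r%:C) <= 2 * (r ^+ 2 * expR `|r|).
Proof.
have e1 : 1 <= expR `|r| by rewrite -expR0 ler_expR.
case: b; rewrite /dir_unit.
  rewrite (_ : 'i%C * r%:C = 0 +i* r); last by simpc.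
  rewrite cexpE expR0 !mul1r; simpc.
  rewrite (le_trans (normc_leRI _))//= mulr_natl mulr2n.
  by apply: lerD; rewrite (le_trans (cos_taylor1 _), le_trans (sin_taylor1 _))//
    ler_peMr// sqr_ge0.
rewrite mul1r cexp_real; simpc.
rewrite (le_trans (normc_leRI _))//= ?subr0 normr0 addr0.
rewrite (le_trans (expR_taylor1 _))// ler_peMl ?ler1n//.
by rewrite mulr_ge0 ?sqr_ge0 ?expR_ge0.
Qed.

Lemma sqr_le_expR r : r ^+ 2 <= 4 * expR `|r|.
Proof.
have rh : `|r| / 2 <= expR (`|r| / 2).
  by rewrite (le_trans _ (expR_ge1Dx _))// lerDr.
have : (`|r| / 2) ^+ 2 <= expR (`|r| / 2) ^+ 2.
  by rewrite ler_sqr ?nnegrE ?expR_ge0 ?divr_ge0.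
rewrite -expRM_natl exprMn real_normK ?num_real//.
have -> : 2%:R * (`|r| / 2) = `|r| by field.
by rewrite exprVn ler_pdivrMr ?exprn_gt0// mulrC -natrX.
Qed.

End cexp_theory.

Section dot_theory.
Variables (R : realType) (n : nat).
Implicit Types x y z : 'rV[R]_n.

Lemma dotC x y : dot x y = dot y x.
Proof. by apply: eq_bigr => i _; rewrite mulrC. Qed.

Lemma dotDl x y z : dot (x + y) z = dot x z + dot y z.
Proof. by rewrite -big_split/=; apply: eq_bigr => i _; rewrite mxE mulrDl. Qed.

Lemma dotZl (c : R) x y : dot (c *: x) y = c * dot x y.
Proof. by rewrite mulr_sumr; apply: eq_bigr => i _; rewrite mxE mulrA. Qed.

Lemma dotNl x y : dot (- x) y = - dot x y.
Proof. by rewrite -scaleN1r dotZl mulN1r. Qed.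

Lemma dotDr x y z : dot z (x + y) = dot z x + dot z y.
Proof. by rewrite dotC dotDl !(dotC z). Qed.

Lemma dotZr (c : R) x y : dot x (c *: y) = c * dot x y.
Proof. by rewrite dotC dotZl dotC. Qed.

Lemma dotNr x y : dot x (- y) = - dot x y.
Proof. by rewrite dotC dotNl dotC. Qed.

Lemma dot0r x : dot x 0 = 0.
Proof. by rewrite -[0 in LHS](scale0r 0) dotZr mul0r. Qed.

Lemma dot0l x : dot 0 x = 0.
Proof. by rewrite dotC dot0r. Qed.

Definition dotE := (dotDl, dotDr, dotNl, dotNr, dotZl, dotZr, dot0l, dot0r).

End dot_theory.

(** * Gaussian exponentials as a differentiable family in L^2 *)

Section gauss.
Variables (R : realType) (n : nat) (h : {posnum R}).
Implicit Types (a u x : 'rV[R]_n) (X Y : phase R n) (t : R).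
Local Notation hR := (h%:num).

Let h0 : hR != 0. Proof. by rewrite gt_eqF. Qed.

(** The part of the coherent state that is holomorphic in x + i xi. *)
Definition gauss X u : R[i] :=
  cexp ((dot u X.1 / hR - dot u u / (2 * hR)) +i* (dot u X.2 / hR)).

Definition coherent_factor X : R[i] :=
  ((pi * hR) `^ (- n%:R / 4))%:C
    * cexp ((- dot X.1 X.1 / (2 * hR)) +i* (- dot X.1 X.2 / (2 * hR))).

Lemma coherent_funM X u : coherent_fun h X u = coherent_factor X * gauss X u.
Proof.
have realM (p q : R) : (p * expR q)%:C = p%:C * cexp q%:C.
  by rewrite cexp_real; simpc.
rewrite /coherent_factor -mulrA /gauss -cexpD /coherent_fun realM -mulrA.
rewrite -cexpD; congr (_ * cexp _); simpc.
congr (_ +i* _).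
  by rewrite !dotE (dotC X.1 u); field.
by field.
Qed.

Lemma coherent_factor_neq0 X : coherent_factor X != 0.
Proof.
rewrite mulf_neq0 ?cexp_neq0// (inj_eq (@complexI R)) gt_eqF//.
by rewrite powR_gt0// mulr_gt0// pi_gt0.
Qed.

Lemma gauss_L2 X : gauss X \in cL2fun_pred (lebesgue_rV R n).
Proof.
rewrite (_ : gauss X =
    fun u => (coherent_factor X)^-1 * CL2fun (coherent_fun_L2 h X) u).
  exact: cL2fun_scale_subproof.
apply/funext => u /=; rewrite coherent_funM mulKf//.
exact: coherent_factor_neq0.
Qed.

Definition gaussf X : cL2fun (lebesgue_rV R n) := CL2fun (gauss_L2 X).

Definition gaussv X : L2 R n := cL2_of (gaussf X).

Lemma coherentE X : coherent h X = coherent_factor X *: gaussv X.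
Proof.
rewrite /coherent /gaussv [_ *: _]cL2_ofZ; congr cL2_of; apply: val_inj => /=.
apply/funext => u /=.
exact: coherent_funM.
Qed.

Definition phase_dir (b : bool) a : phase R n := if b then (0, a) else (a, 0).

Lemma gauss_shift b a t X u :
  gauss (t *: phase_dir b a + X) u =
  gauss X u * cexp (dir_unit R b * (t * (dot u a / hR))%:C).
Proof.
rewrite /gauss -cexpD; congr cexp; case: X => x xi.
case: b; rewrite /dir_unit /=.
  have -> : 'i%C * (t * (dot u a / hR))%:C = 0 +i* (t * (dot u a / hR)) by simpc.
  by simpc; rewrite !dotE mulr0 add0r; congr (_ +i* _); field.
by rewrite mul1r; simpc; rewrite !dotE mulr0 add0r; congr (_ +i* _); field.
Qed.

Lemma normc_gauss X u : normc (gauss X u) = expR (dot u X.1 / hR - dot u u / (2 * hR)).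
Proof. by rewrite normc_cexp. Qed.

(** Its modulus is |E_X(u)| times exp (2 u.a / h) + exp (- 2 u.a / h), hence it
dominates every exponential growth of rate 2 |u.a| / h while staying in L^2. *)
Definition dominator X a : cL2fun (lebesgue_rV R n) :=
  gaussf (X.1 + 2 *: a, 0) + gaussf (X.1 - 2 *: a, 0).

Lemma dominatorE X a u : normc (dominator X a u) =
  normc (gauss X u) * (expR (2 * (dot u a / hR)) + expR (- (2 * (dot u a / hR)))).
Proof.
rewrite [dominator X a u](_ : _ =
  gauss (X.1 + 2 *: a, 0) u + gauss (X.1 - 2 *: a, 0) u)//.
have realE x : gauss (x, 0) u = (expR (dot u x / hR - dot u u / (2 * hR)))%:C.
  by rewrite /gauss /= dot0r mul0r cexp_real.
rewrite !realE -rmorphD normc_real ger0_norm ?addr_ge0 ?expR_ge0//.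
rewrite normc_gauss mulrDr -!expRD; congr (expR _ + expR _); rewrite !dotE; field.
- exact: h0.
- exact: h0.
Qed.

Lemma expR_norm_le_dominator X a u :
  normc (gauss X u) * expR (2 * `|dot u a / hR|) <= normc (dominator X a u).
Proof.
rewrite dominatorE ler_wpM2l ?normc_ge0//.
by case: ger0P => _; rewrite ?mulrN ?lerDl ?lerDr expR_ge0.
Qed.

(** The derivative of E_X(u) along (a, 0). *)
Definition dgauss X a u : R[i] := (dot u a / hR)%:C * gauss X u.

Lemma dgauss_L2 X a : dgauss X a \in cL2fun_pred (lebesgue_rV R n).
Proof.
have md : measurable_fun setT (fun u => dot u a / hR).
  by apply: measurable_funM => //; exact: measurable_dotl.
have [mr mi] := cL2fun_cmeasurable (gaussf X).
have mD : cmeasurable (dgauss X a).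
  split.
    rewrite (_ : (fun _ => _) = fun u => (dot u a / hR) * Re (gauss X u)).
      exact: measurable_funM.
    by apply/funext => u; rewrite /dgauss; case: (gauss X u) => ? ?; simpc.
  rewrite (_ : (fun _ => _) = fun u => (dot u a / hR) * Im (gauss X u)).
    exact: measurable_funM.
  by apply/funext => u; rewrite /dgauss; case: (gauss X u) => ? ?; simpc.
apply/asboolP; split => //.
have /asboolP[_ lH] := cL2funP (dominator X a).
apply: finite_norm_le lH.
- exact: measurable_normc.
- exact/measurable_normc/cL2fun_cmeasurable.
move=> u; apply/andP; split; first exact: normc_ge0.
apply: le_trans (expR_norm_le_dominator X a u).
rewrite /dgauss normcM normc_real mulrC ler_wpM2l ?normc_ge0//.
have := expR_ge1Dx (2 * `|dot u a / hR|); apply: le_trans.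
by rewrite mulr_natl mulr2n addrA lerDr addr_ge0.
Qed.

Definition dgaussf X a : cL2fun (lebesgue_rV R n) := CL2fun (dgauss_L2 X a).

Definition dgaussv X a : L2 R n := cL2_of (dgaussf X a).

(** Along t |-> X + t (a, 0) or X + t (0, a) the function E_X gets multiplied by
exp (t u.a / h) or exp (i t u.a / h); after the second-order estimate of this
factor, the polynomial growth (u.a / h)^2 is absorbed into one more exponential,
which is where the factor 8 = 2 * 4 comes from. *)
Lemma gaussv_taylor1 b a t X : `|t| <= 1 ->
  cL2_norm (gaussv (t *: phase_dir b a + X) - gaussv X
              - (t%:C * dir_unit R b) *: dgaussv X a)
  <= 8 * t ^+ 2 * cL2_norm (cL2_of (dominator X a)).
Proof.
move=> t1.
rewrite /gaussv /dgaussv [(_ * _) *: _]cL2_ofZ !cL2_ofB.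
apply: le_cL2_norm => [|u]; first by rewrite mulr_ge0 ?sqr_ge0.
set m := dot u a / hR.
have -> : (gaussf (t *: phase_dir b a + X) - gaussf X -
    cL2fun_scale (t%:C * dir_unit R b) (dgaussf X a)) u =
    gauss X u * (cexp (dir_unit R b * (t * m)%:C) - 1 - dir_unit R b * (t * m)%:C).
  rewrite [LHS](_ : _ = gauss (t *: phase_dir b a + X) u - gauss X u
    - t%:C * dir_unit R b * (m%:C * gauss X u))//.
  by rewrite gauss_shift -/m rmorphM; ring.
rewrite normcM; apply: (@le_trans _ _
    (normc (gauss X u) * (2 * ((t * m) ^+ 2 * expR `|t * m|)))).
  by rewrite ler_wpM2l ?normc_ge0// cexp_taylor1.
apply: (@le_trans _ _ (8 * t ^+ 2 * (normc (gauss X u) * expR (2 * `|m|)))); last first.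
  rewrite ler_wpM2l//; last exact: expR_norm_le_dominator.
  by apply: mulr_ge0 => //; exact: sqr_ge0.
rewrite [leRHS]mulrCA ler_wpM2l ?normc_ge0//.
have etm : expR `|t * m| <= expR `|m|.
  by rewrite ler_expR normrM ler_piMl.
rewrite expRM_natl exprMn [expR _ ^+ 2]expr2.
have -> : 8 * t ^+ 2 * (expR `|m| * expR `|m|) =
   2 * (t ^+ 2 * (4 * expR `|m|) * expR `|m|) by ring.
rewrite ler_wpM2l//; apply: ler_pM => //; rewrite ?expR_ge0//.
  by rewrite mulr_ge0 ?sqr_ge0.
by rewrite ler_wpM2l ?sqr_ge0// sqr_le_expR.
Qed.

(** The Cauchy-Riemann equations in weak form: the derivatives along (a, 0) and
(0, a) are d and i d for one and the same d. *)
Lemma is_cderive_gaussv (L : L2 R n -> R[i]) (K : R) X b a :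
  (forall c p q, L (c *: p + q) = c * L p + L q) ->
  (forall p, normc (L p) <= K * cL2_norm p) ->
  is_cderive (fun Y => L (gaussv Y)) X (phase_dir b a)
    (dir_unit R b * L (dgaussv X a)).
Proof.
move=> Llin LK.
have LB p q : L (p - q) = L p - L q.
  by rewrite addrC -scaleN1r Llin mulN1r addrC.
have LZ c p : L (c *: p) = c * L p.
  have L0 : L 0 = 0 by have := LB 0 0; rewrite !subrr.
  by rewrite -[c *: p]addr0 Llin L0 addr0.
pose N := cL2_norm (cL2_of (dominator X a)).
apply: (is_cderive_sqr_remainder (C := `|K| * (8 * N))) => t t1.
rewrite mulrA -LZ -!LB (le_trans (LK _))//.
apply: le_trans (ler_wpM2r (cL2_norm_ge0 _) (ler_norm K)) _.
rewrite -mulrA ler_wpM2l// mulrAC; exact: gaussv_taylor1.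
Qed.

End gauss.

(** * Overlap of two Gaussian exponentials *)

Section overlap.
Variables (R : realType) (n : nat) (h : {posnum R}).
Implicit Types (a u x xi : 'rV[R]_n) (X Y Z : phase R n) (t : R).
Local Notation hR := (h%:num).

Let h0 : hR != 0. Proof. by rewrite gt_eqF. Qed.

(** The Laplace transform of exp (- |u|^2 / h) at the complex point
(Z.1 + i Z.2) / h. *)
Definition gauss_laplace Z : R[i] :=
  cintegral (lebesgue_rV R n) (fun u =>
    cexp ((dot u Z.1 / hR - dot u u / hR) +i* (dot u Z.2 / hR))).

Lemma gauss_mul_conj X Y u : gauss h X u * (gauss h Y u)^* =
  cexp ((dot u (X.1 + Y.1) / hR - dot u u / hR) +i* (dot u (X.2 - Y.2) / hR)).
Proof.
have addJ (a b c d : R) : (a +i* b) + conjc (c +i* d) = (a + c) +i* (b - d) by [].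
rewrite [X in _ * X](cexp_conj _) -cexpD addJ.
by congr cexp; congr (_ +i* _); rewrite !dotE; field.
Qed.

Lemma gaussv_inner X Y :
  cL2_inner (gaussv h X) (gaussv h Y) = gauss_laplace (X.1 + Y.1, X.2 - Y.2).
Proof.
rewrite cL2_inner_of; congr cintegral; apply/funext => u.
exact: gauss_mul_conj.
Qed.

Lemma gaussv_inner0 X : cL2_inner (gaussv h X) (gaussv h 0) = gauss_laplace X.
Proof. by rewrite gaussv_inner addr0 subr0; case: X. Qed.

Let integrandE Z :
  (fun u => cexp ((dot u Z.1 / hR - dot u u / hR) +i* (dot u Z.2 / hR))) =
  (fun u => gaussf h Z u * (gaussf h 0 u)^*).
Proof. by apply/funext => u; rewrite gauss_mul_conj addr0 subr0. Qed.

Lemma cintegral_translate a (f : 'rV[R]_n -> R[i]) : cmeasurable f ->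
  cintegral (lebesgue_rV R n) (fun u => f (u + a)) = cintegral (lebesgue_rV R n) f.
Proof.
move=> [mr mi]; rewrite /cintegral /Rintegral; congr (fine _ +i* fine _).
- by rewrite -[RHS](integral_rV_translate a)//; exact/measurable_EFinP.
- by rewrite -[RHS](integral_rV_translate a)//; exact/measurable_EFinP.
Qed.

(** Completing the square in the real part, by the change of variables
u + x / 2. *)
Lemma gauss_laplace_translate x xi :
  gauss_laplace (x, xi) =
  cexp ((dot x x / (4 * hR)) +i* (dot x xi / (2 * hR))) * gauss_laplace (0, xi).
Proof.
rewrite {1}/gauss_laplace -(cintegral_translate (2^-1 *: x)); last first.
  rewrite integrandE; apply: cmeasurable_mul_conj; exact: cL2fun_cmeasurable.
rewrite -cintegralZ; last by rewrite integrandE; exact: cintegrable_mul_conj.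
congr cintegral; apply/funext => u; rewrite -cexpD; congr cexp; simpc.
by congr (_ +i* _); rewrite /= !dotE ?(dotC x u); field.
Qed.

Lemma is_cderive_gauss_laplace b X a :
  is_cderive gauss_laplace X (phase_dir b a)
    (dir_unit R b * cL2_inner (dgaussv h X a) (gaussv h 0)).
Proof.
rewrite (_ : gauss_laplace = fun Y => cL2_inner (gaussv h Y) (gaussv h 0)).
  apply: (@is_cderive_gaussv R n h (fun p => cL2_inner p (gaussv h 0))
    (2 * cL2_norm (gaussv h 0))) => [c p q|p].
    exact: cL2_inner_linear.
  by rewrite -mulrA [_ * cL2_norm p]mulrC; exact: normc_cL2_inner_le.
by apply/funext => Y; rewrite gaussv_inner0.
Qed.

(** The derivative along (xi, 0), computed in two ways: abstractly, and on the
formula of [gauss_laplace_translate], whose exponent s^2 c / 2 + i s t c has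
derivative i t c at s = 0. *)
Lemma gauss_laplace_dx xi t :
  cL2_inner (dgaussv h (0, t *: xi) xi) (gaussv h 0) =
  'i%C * (t * (dot xi xi / (2 * hR)))%:C * gauss_laplace (0, t *: xi).
Proof.
pose c := dot xi xi / (2 * hR).
pose E (s : R^o) : R[i] := cexp ((s ^+ 2 * (c / 2)) +i* (s * (t * c))).
have dE : is_cderive E 0 1 ('i%C * (t * c)%:C).
  have De : is_derive (0 : R^o) 1 (fun s : R => expR (s ^+ 2 * (c / 2))) 0.
    by apply: is_derive_eq; rewrite /GRing.scale/=; ring.
  have Dc : is_derive (0 : R^o) 1 (fun s : R => cos (s * (t * c))) 0.
    by apply: is_derive_eq; rewrite /GRing.scale/= mul0r sin0; ring.
  have Ds : is_derive (0 : R^o) 1 (fun s : R => sin (s * (t * c))) (t * c).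
    by apply: is_derive_eq; rewrite /GRing.scale/= mul0r cos0; ring.
  split.
    have := is_deriveM De Dc; congr is_derive.
      by apply/funext => s; rewrite /E cexpE.
    by rewrite /GRing.scale/=; simpc => /=; ring.
  have := is_deriveM De Ds; congr is_derive.
    by apply/funext => s; rewrite /E cexpE.
  by rewrite /GRing.scale/= expr0n mul0r expR0 /=; simpc => /=; ring.
have dK (g : R[i]) : is_cderive (fun _ : R^o => g) 0 1 0.
  by split; exact: is_derive_cst.
have := is_cderiveM dE (dK (gauss_laplace (0, t *: xi))).
have E0 : E 0 = 1 by rewrite /E expr0n !mul0r cexp0.
rewrite mulr0 addr0 => /is_cderive_val <-; apply/esym.
have := is_cderive_gauss_laplace false (0, t *: xi) xi.
rewrite /dir_unit mul1r => H; apply: is_cderive_val.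
apply: is_cderive_line H => s.
rewrite [in RHS]/= (_ : _ + _ = (s *: xi, t *: xi)); last first.
  by congr pair; rewrite /= ?scaler0 ?addr0 ?add0r.
rewrite [RHS]gauss_laplace_translate /E; congr (_ * _); congr cexp.
by rewrite !dotE /c [s *: 1]mulr1 addr0; congr (_ +i* _); field.
Qed.

Lemma gauss_decay (r : R -> R) (c : R) :
  (forall t, is_derive t (1 : R^o) r (- (2 * c * t * r t))) ->
  r 1 = expR (- c) * r 0.
Proof.
move=> Dr.
pose s t := r t * expR (c * t ^+ 2).
have Ds t : is_derive t (1 : R^o) (s : R^o -> R^o) 0.
  have De : is_derive (t : R^o) 1 (fun t : R => expR (c * t ^+ 2))
      (2 * c * t * expR (c * t ^+ 2)).
    by apply: is_derive_eq; rewrite /GRing.scale/=; ring.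
  have := is_deriveM (Dr t) De; congr is_derive.
  by rewrite /GRing.scale/=; ring.
have := is_derive_0_is_cst 1 0 Ds.
rewrite /s expr1n mulr1 expr0n/= mulr0 expR0 mulr1 => <-.
by rewrite mulrCA -expRD addNr expR0 mulr1.
Qed.

(** On the line t |-> (0, t xi), the Cauchy-Riemann equations turn the derivative
of [gauss_laplace_dx] into g' = - 2 c t g, solved at t = 1. *)
Lemma gauss_laplace_imag xi :
  gauss_laplace (0, xi) = (expR (- (dot xi xi / (4 * hR))))%:C * gauss_laplace 0.
Proof.
pose c := dot xi xi / (4 * hR).
pose g (t : R^o) := gauss_laplace (0, t *: xi).
have Dg t : is_cderive g t 1 (- (2 * c * t)%:C * g t).
  have := is_cderive_gauss_laplace true (0, t *: xi) xi.
  have iiE (z w : R[i]) : 'i%C * ('i%C * z * w) = - z * w.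
    by rewrite !mulrA -expr2 sqr_i mulN1r.
  rewrite gauss_laplace_dx /dir_unit iiE -/(g t).
  rewrite (_ : t * (dot xi xi / (2 * hR)) = 2 * c * t); last by rewrite /c; field.
  apply: is_cderive_line => s; rewrite /g; congr gauss_laplace.
  congr pair; first by rewrite /= scaler0 addr0.
  by rewrite /= [s *: 1]mulr1 scalerDl.
have g1 : g 1 = gauss_laplace (0, xi) by rewrite /g scale1r.
have g0 : g 0 = gauss_laplace 0 by rewrite /g scale0r.
rewrite -g1 -g0 -/c.
have rE : Re (g 1) = expR (- c) * Re (g 0).
  apply: (gauss_decay (r := fun t => Re (g t))) => t; have [+ _] := Dg t.
  by congr is_derive; case: (g t) => x y; simpc => /=.
have iE : Im (g 1) = expR (- c) * Im (g 0).
  apply: (gauss_decay (r := fun t => Im (g t))) => t; have [_ +] := Dg t.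
  by congr is_derive; case: (g t) => x y; simpc => /=.
by case: (g 1) (g 0) rE iE => [? ?] [? ?] /= -> ->; simpc.
Qed.

Lemma integral_gauss : (\int[@lebesgue_measure R]_t (expR (- t ^+ 2 / hR))%:E =
  (Num.sqrt (pi * hR))%:E)%E.
Proof.
pose s : R := Num.sqrt (hR / 2).
have s0 : s != 0 by rewrite gt_eqF// sqrtr_gt0 divr_gt0.
have sE : s ^+ 2 *+ 2 = hR.
  by rewrite sqr_sqrtr ?divr_ge0// -mulr_natr divfK.
have pE t : expR (- t ^+ 2 / hR) = (normal_peak s)^-1 * normal_pdf 0 s t.
  rewrite normal_pdfE// mulrA mulVf ?mul1r ?gt_eqF ?normal_peak_gt0//.
  by rewrite /normal_fun sE subr0.
under eq_integral do rewrite pE EFinM.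
rewrite ge0_integralZl//.
- rewrite integral_normal_pdf mule1 /normal_peak invrK; congr (Num.sqrt _)%:E.
  by rewrite -[in RHS]sE mulrC mulrnAr mulrnAl.
- by apply/measurable_EFinP; exact: measurable_normal_pdf.
- by move=> t _; rewrite lee_fin normal_pdf_ge0.
- by rewrite lee_fin invr_ge0 normal_peak_ge0.
Qed.

Lemma gauss_laplace0 : gauss_laplace 0 = (Num.sqrt (pi * hR) ^+ n)%:C.
Proof.
rewrite /gauss_laplace /cintegral.
have E (u : 'rV[R]_n) : cexp ((dot u 0 / hR - dot u u / hR) +i* (dot u 0 / hR)) =
    (\prod_(i < n) expR (- (u ord0 i) ^+ 2 / hR))%:C.
  rewrite dot0r mul0r sub0r [_ +i* 0]complexr0 cexp_real -expR_sum.
  congr (expR _)%:C; rewrite -mulNr -sumrN mulr_suml.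
  by apply: eq_bigr => i _; rewrite expr2.
under [X in X +i* _]eq_Rintegral do rewrite E.
under [X in _ +i* X]eq_Rintegral do rewrite E.
rewrite /= Rintegral_cst// mul0r /Rintegral.
rewrite (@integral_rV_prod R n (fun i t => expR (- t ^+ 2 / hR))).
- under eq_bigr do rewrite integral_gauss.
  by rewrite prodEFin big_const_ord iter_mulr_1.
- move=> i; apply: measurableT_comp => //; apply: measurable_funM => //.
  by apply: measurableT_comp => //; apply: measurable_funX.
- by move=> i t; exact: expR_ge0.
Qed.

(** In complex notation, with z = x + i xi and w = y + i eta, the exponent is
(z + conj w)^2 / 4h. *)
Lemma gaussv_innerE X Y : cL2_inner (gaussv h X) (gaussv h Y) =
  (Num.sqrt (pi * hR) ^+ n)%:C *
  cexp (((dot (X.1 + Y.1) (X.1 + Y.1) - dot (X.2 - Y.2) (X.2 - Y.2)) / (4 * hR))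
        +i* (dot (X.1 + Y.1) (X.2 - Y.2) / (2 * hR))).
Proof.
rewrite gaussv_inner gauss_laplace_translate gauss_laplace_imag gauss_laplace0.
rewrite mulrA mulrC; congr (_ * _); rewrite -cexp_real -cexpD; congr cexp.
by simpc; congr (_ +i* _); ring.
Qed.

Lemma gaussv_inner_neq0 X Y : cL2_inner (gaussv h X) (gaussv h Y) != 0.
Proof.
rewrite gaussv_innerE mulf_neq0 ?cexp_neq0// (inj_eq (@complexI R)).
by rewrite expf_neq0// gt_eqF// sqrtr_gt0 mulr_gt0// pi_gt0.
Qed.

Lemma powR_sqrt_pi : ((pi * hR) `^ (- n%:R / 4)) ^+ 2 * Num.sqrt (pi * hR) ^+ n = 1.
Proof.
have p0 : 0 < pi * hR :> R by rewrite mulr_gt0// pi_gt0.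
rewrite -powR12_sqrt ?ltW// -!powR_mulrn ?powR_ge0// -!powRrM -powRD; last first.
  by rewrite (gt_eqF p0) implybT.
by rewrite (_ : _ + _ = 0) ?powRr0//; field.
Qed.

Lemma coherent_inner_norm X Y :
  normc (cL2_inner (coherent h X) (coherent h Y)) =
  expR (- (norm2_phase (X - Y) / (4 * hR))).
Proof.
have nM (r : R) (z : R[i]) : 0 <= r -> normc (r%:C * cexp z) = r * expR (Re z).
  by move=> r0; rewrite normcM normc_cexp normc_real ger0_norm.
rewrite !coherentE cL2_innerZl cL2_innerZr gaussv_innerE.
rewrite (normcM (coherent_factor _ _)) (normcM (conjc _)) normc_conj.
rewrite /coherent_factor !nM ?powR_ge0 ?exprn_ge0 ?sqrtr_ge0//=.
set P := _ `^ _; set S := _ ^+ n; set e1 := expR _; set e2 := expR _; set e3 := expR _.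
have -> : P * e1 * (P * e2 * (S * e3)) = P ^+ 2 * S * (e1 * e2 * e3) by ring.
rewrite powR_sqrt_pi mul1r -!expRD; congr expR; rewrite /norm2_phase /= !dotE.
by rewrite (dotC Y.1 X.1) (dotC Y.2 X.2); field.
Qed.

Lemma coherent_inner_self X : cL2_inner (coherent h X) (coherent h X) = 1.
Proof.
rewrite coherentE cL2_innerZl cL2_innerZr gaussv_innerE /coherent_factor.
rewrite conjcM conjc_real cexp_conj.
set P := _ `^ _; set S := _ ^+ n; set e1 := cexp _; set e2 := cexp _; set e3 := cexp _.
have -> : P%:C * e1 * (P%:C * e2 * (S%:C * e3)) = (P ^+ 2 * S)%:C * (e1 * e2 * e3).
  by rewrite !rmorphM; ring.
rewrite powR_sqrt_pi mul1r -!cexpD -[RHS]cexp0; congr cexp; simpc.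
by congr (_ +i* _); rewrite !dotE; field.
Qed.

End overlap.

(** * The Berezin symbol *)

Section berezin.
Variables (R : realType) (n : nat) (h : {posnum R}).
Variables (A : {linear L2 R n -> L2 R n}) (bA : cL2_bounded A).
Implicit Types (a : 'rV[R]_n) (X Y : phase R n).

(** The sesquilinear form of B on Gaussian exponentials; B = id gives the
denominator of the Berezin symbol. *)
Definition gauss_form (B : L2 R n -> L2 R n) (XY : phase R n * phase R n) : R[i] :=
  cL2_inner (B (gaussv h XY.1)) (gaussv h XY.2).

Lemma berezinE XY : berezin h A XY = gauss_form A XY / gauss_form id XY.
Proof.
rewrite /berezin /gauss_form !coherentE linearZ !cL2_innerZl !cL2_innerZr.
have c1 := coherent_factor_neq0 h XY.1.
have c2 : conjc (coherent_factor h XY.2) != 0.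
  by rewrite conjc_eq0; exact: coherent_factor_neq0.
have G0 := gaussv_inner_neq0 h XY.1 XY.2.
by field; rewrite G0 c1 c2.
Qed.

(** The form is a bounded linear functional of E_X, so it is holomorphic in the
first point. *)
Lemma gauss_form_dl (B : L2 R n -> L2 R n) X Y a (M : R) :
  (forall c p q, B (c *: p + q) = c *: B p + B q) ->
  (forall p, cL2_norm (B p) <= M * cL2_norm p) ->
  exists d : R[i], forall b,
    is_cderive (gauss_form B) (X, Y) (phase_dir b a, 0) (dir_unit R b * d).
Proof.
move=> Blin BM; exists (cL2_inner (B (dgaussv h X a)) (gaussv h Y)) => b.
apply: (is_cderive_line (g := fun X => cL2_inner (B (gaussv h X)) (gaussv h Y))
    (q := X) (w := phase_dir b a)) => [t|].
  by rewrite /gauss_form /= scaler0 add0r.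
apply: (@is_cderive_gaussv R n h (fun p => cL2_inner (B p) (gaussv h Y))
    (2 * (M * cL2_norm (gaussv h Y)))) => [c p q|p].
  by rewrite Blin cL2_inner_linear.
apply: le_trans (normc_cL2_inner_le _ _) _.
rewrite -!mulrA ler_wpM2l// [_ * cL2_norm p]mulrC mulrA ler_wpM2r//.
exact: cL2_norm_ge0.
Qed.

(** In its second argument the form is the conjugate of a bounded linear
functional, whence the conjugate unit. *)
Lemma gauss_form_dr (B : L2 R n -> L2 R n) X Y a :
  exists d : R[i], forall b,
    is_cderive (gauss_form B) (X, Y) (0, phase_dir b a) (conjc (dir_unit R b) * d).
Proof.
pose L p := cL2_inner p (B (gaussv h X)).
exists (conjc (L (dgaussv h Y a))) => b.
apply: (is_cderive_line (g := fun Y => conjc (L (gaussv h Y)))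
    (q := Y) (w := phase_dir b a)) => [t|].
  by rewrite /gauss_form /= scaler0 add0r cL2_inner_conj.
have [rL iL] : is_cderive (fun Y => L (gaussv h Y)) Y (phase_dir b a)
    (dir_unit R b * L (dgaussv h Y a)).
  apply: (@is_cderive_gaussv R n h L (2 * cL2_norm (B (gaussv h X)))) => [c p q|p].
    exact: cL2_inner_linear.
  by rewrite -mulrA [_ * cL2_norm p]mulrC; exact: normc_cL2_inner_le.
rewrite (_ : conjc _ * conjc _ = conjc (dir_unit R b * L (dgaussv h Y a))); last first.
  by rewrite conjcM.
split.
  move: rL; congr is_derive.
  by case: (dir_unit _ _ * _).
have := is_deriveN iL; congr is_derive.
by case: (dir_unit _ _ * _).
Qed.

(** The quotient rule preserves a Cauchy-Riemann relation shared by numerator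
and denominator. The family v lists two conjugate directions and k the units
attached to them: 1 and i for the first point, 1 and - i for the second. *)
Lemma berezin_is_cderive X Y (k : bool -> R[i]) (v : bool -> phase R n * phase R n) :
  k false = 1 ->
  (exists d : R[i], forall b, is_cderive (gauss_form A) (X, Y) (v b) (k b * d)) ->
  (exists e : R[i], forall b, is_cderive (gauss_form id) (X, Y) (v b) (k b * e)) ->
  [/\ cderivable (berezin h A) (X, Y) (v false),
      cderivable (berezin h A) (X, Y) (v true) &
      cderive (berezin h A) (X, Y) (v true) =
        k true * cderive (berezin h A) (X, Y) (v false)].
Proof.
move=> k0 [d dA] [e dI].
pose f := gauss_form A (X, Y); pose g := gauss_form id (X, Y).
have g0 : g != 0 by exact: gaussv_inner_neq0.
have D b : is_cderive (berezin h A) (X, Y) (v b) (k b * ((d * g - f * e) / g ^+ 2)).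
  rewrite (_ : k b * _ = (k b * d * g - f * (k b * e)) / g ^+ 2); last by field.
  rewrite (_ : berezin h A = fun XY => gauss_form A XY / gauss_form id XY).
    exact: is_cderive_div.
  by apply/funext => XY; exact: berezinE.
split; [exact: is_cderive_cderivable (D _)|exact: is_cderive_cderivable (D _)|].
by rewrite !(is_cderive_val (D _)) k0 mul1r.
Qed.

Lemma berezin_holomorphic_l X Y a :
  [/\ cderivable (berezin h A) (X, Y) ((a, 0), 0),
      cderivable (berezin h A) (X, Y) ((0, a), 0) &
      cderive (berezin h A) (X, Y) ((a, 0), 0)
        + 'i%C * cderive (berezin h A) (X, Y) ((0, a), 0) = 0].
Proof.
have [M AM] := bA.
have dA := gauss_form_dl X Y a (fun c p q => linearP A c p q) AM.
have dI : exists e : R[i], forall b,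
    is_cderive (gauss_form id) (X, Y) (phase_dir b a, 0) (dir_unit R b * e).
  by apply: (@gauss_form_dl id X Y a 1) => // p; rewrite mul1r.
have [Dx Dxi ->] := berezin_is_cderive (v := fun b => (phase_dir b a, 0)) erefl dA dI.
split; [exact: Dx|exact: Dxi|].
rewrite /dir_unit mulrA (_ : 'i%C * 'i%C = -1) ?mulN1r ?subrr//.
by rewrite -expr2 sqr_i.
Qed.

Lemma berezin_antiholomorphic_r X Y a :
  [/\ cderivable (berezin h A) (X, Y) (0, (a, 0)),
      cderivable (berezin h A) (X, Y) (0, (0, a)) &
      cderive (berezin h A) (X, Y) (0, (a, 0))
        - 'i%C * cderive (berezin h A) (X, Y) (0, (0, a)) = 0].
Proof.
have [Dy Deta ->] := berezin_is_cderive (v := fun b => (0, phase_dir b a))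
  (k := fun b => conjc (dir_unit R b)) (conjc1 R)
  (gauss_form_dr A X Y a) (gauss_form_dr id X Y a).
split; [exact: Dy|exact: Deta|].
rewrite mulrA (_ : 'i%C * conjc (dir_unit R true) = 1) ?mul1r ?subrr//.
by rewrite /dir_unit; simpc.
Qed.

Lemma berezin_diag X : berezin h A (X, X) = wick h A X.
Proof. by rewrite /berezin /wick coherent_inner_self divr1. Qed.

Lemma berezin_le X Y :
  ((normc (berezin h A (X, Y)))%:E <=
     confinement h A (X - Y)%R
     * (expR (norm2_phase (X - Y) / (4 * h%:num))%R)%:E)%E.
Proof.
rewrite /berezin normcM normcV coherent_inner_norm -expRN opprK EFinM.
rewrite lee_wpmul2r ?lee_fin ?expR_ge0//.
by apply: ereal_sup_ubound; exists (X, Y).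
Qed.

End berezin.

Theorem theorem2p2 (R : realType) (n : nat) (h : {posnum R})
    (A : {linear L2 R n -> L2 R n}) (bA : cL2_bounded A) :
  [/\ (forall (X Y : phase R n) (j : 'I_n),
        [/\ cderivable (berezin h A) (X, Y) (dir_x R j),
            cderivable (berezin h A) (X, Y) (dir_xi R j),
            cderive (berezin h A) (X, Y) (dir_x R j)
              + 'i%C * cderive (berezin h A) (X, Y) (dir_xi R j) = 0 &
            [/\ cderivable (berezin h A) (X, Y) (dir_y R j),
                cderivable (berezin h A) (X, Y) (dir_eta R j) &
                cderive (berezin h A) (X, Y) (dir_y R j)
                  - 'i%C * cderive (berezin h A) (X, Y) (dir_eta R j) = 0]]),
      (forall X : phase R n, berezin h A (X, X) = wick h A X) &
      (A \in Ch h -> forall X Y : phase R n,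
        ((normc (berezin h A (X, Y)))%:E <=
           confinement h A (X - Y)%R
           * (expR (norm2_phase (X - Y) / (4 * h%:num))%R)%:E)%E)].
Proof.
split=> [X Y j|X|_ X Y].
- have [Dx Dxi CRX] := berezin_holomorphic_l h bA X Y (delta_mx ord0 j).
  have [Dy Deta CRY] := berezin_antiholomorphic_r h A X Y (delta_mx ord0 j).
  split; [exact: Dx|exact: Dxi|exact: CRX|].
  by split; [exact: Dy|exact: Deta|exact: CRY].
- exact: berezin_diag.
- exact: berezin_le.
Qed.
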